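(* Let $V$ be the first fundamental $U_{r,s}(\mathfrak{so}_{2n})$-module ($n\ge2$) with basis $v_1,\dots,v_{2n}$ described in the context. The $U_{r,s}(\mathfrak{so}_{2n})$-module isomorphism $\hat R_{VV}=\Theta\circ\widetilde f\circ\tau\colon V\otimes V\to V\otimes V$ coincides with the operator $$\begin{aligned}\hat R={}& r^{-1/2}s^{1/2}\sum_{i=1}^{2n}E_{ii}\otimes E_{ii}+r^{1/2}s^{-1/2}\sum_{i=1}^{2n}E_{ii'}\otimes E_{i'i}+\sum_{1\le i,j\le 2n,\ j\ne i,i'}a_{ij}E_{ij}\otimes E_{ji}\\&+(s-r)(rs)^{-1/2}\sum_{i=1}^n\bigl(1-r^{n-i}s^{i-n}\bigr)E_{i'i'}\otimes E_{ii}\\&+(s-r)(rs)^{-1/2}\sum_{i>j,\ j\ne i'}E_{ii}\otimes E_{jj}+(r-s)(rs)^{-1/2}\sum_{i<j,\ j\neq i'}t_it_j^{-1}E_{i'j}\otimes E_{ij'},\end{aligned}$$ where $t_i=s^{i-n}$ if $i\le n$ and $t_i=r^{n+1-i}$ if $i>n$; $\sigma_i=1$ if $i\le n$ and $\sigma_i=-1$ if $i>n$; and $a_{ij}=(rs)^{-\frac12\sigma_i\sigma_j}$ if ($i<j$ and $i<j'$) or ($i>j$ and $i>j'$), while $a_{ij}=(rs)^{\frac12\sigma_i\sigma_j}$ if $j<i<j'$ or $j'<i<j$.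
   Context: $\mathbb K$ is an algebraically closed field containing $\mathbb C(r,s)$ with $r,s$ indeterminates; square roots $r^{1/2},s^{1/2}\in\mathbb K$ are fixed and $(rs)^{1/2}=r^{1/2}s^{1/2}$. **Root data (type $D_n$).** $\varepsilon_1,\dots,\varepsilon_n$ is an orthonormal basis of $\mathbb R^n$; $\alpha_i=\varepsilon_i-\varepsilon_{i+1}$ ($i<n$), $\alpha_n=\varepsilon_{n-1}+\varepsilon_n$; $Q=\bigoplus\mathbb Z\alpha_i$. $c_{ij}=2(\alpha_i,\alpha_j)/(\alpha_i,\alpha_i)$, $d_i=1$, $r_i=r$, $s_i=s$. $\langle\cdot,\cdot\rangle$ is the ($\frac12\mathbb Z$-valued) bilinear form on $\bigoplus\mathbb Z\varepsilon_i$ with $\langle\varepsilon_i,\varepsilon_i\rangle=\frac12$, $\langle\varepsilon_i,\varepsilon_j\rangle=-\frac12$ for $i<j$ and $=\frac12$ for $i>j$; equivalently it is the bilinear extension of the form with $\langle\alpha_{n-1},\alpha_n\rangle=-1$, $\langle\alpha_n,\alpha_{n-1}\rangle=1$ and otherwise $\langle\alpha_i,\alpha_j\rangle=c_{ij}$ if $i<j$, $1$ if $i=j$, $0$ if $i>j$. **Algebra.** $[m]_{r,s}=\frac{r^m-s^m}{r-s}$, $[m]_{r,s}!=[m]_{r,s}\cdots[1]_{r,s}$, $\genfrac{[}{]}{0pt}{}{m}{k}_{r,s}=\frac{[m]_{r,s}!}{[m-k]_{r,s}![k]_{r,s}!}$. $U_{r,s}=U_{r,s}(\mathfrak{so}_{2n})$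 is the associative $\mathbb K$-algebra generated by $e_i,f_i,\omega_i^{\pm1},(\omega_i')^{\pm1}$ ($1\le i\le n$) with relations: all $\omega_i^{\pm1},(\omega'_j)^{\pm1}$ commute and $\omega_i\omega_i^{-1}=1=\omega_i'(\omega_i')^{-1}$; $\omega_ie_j=r^{\langle\alpha_j,\alpha_i\rangle}s^{-\langle\alpha_i,\alpha_j\rangle}e_j\omega_i$, $\omega_if_j=r^{-\langle\alpha_j,\alpha_i\rangle}s^{\langle\alpha_i,\alpha_j\rangle}f_j\omega_i$, $\omega_i'e_j=r^{-\langle\alpha_i,\alpha_j\rangle}s^{\langle\alpha_j,\alpha_i\rangle}e_j\omega_i'$, $\omega_i'f_j=r^{\langle\alpha_i,\alpha_j\rangle}s^{-\langle\alpha_j,\alpha_i\rangle}f_j\omega_i'$; $e_if_j-f_je_i=\delta_{ij}\frac{\omega_i-\omega_i'}{r_i-s_i}$; and for $i\ne j$, $\sum_{k=0}^{1-c_{ij}}(-1)^k\genfrac{[}{]}{0pt}{}{1-c_{ij}}{k}_{r_i,s_i}(r_is_i)^{k(k-1)/2}(rs)^{k\langle\alpha_j,\alpha_i\rangle}e_i^{1-c_{ij}-k}e_je_i^k=0$ and the same with $e_i^{1-c_{ij}-k}e_je_i^k$ replaced by $f_i^kf_jf_i^{1-c_{ij}-k}$. Coproduct: $\omega_i,\omega_i'$ are group-like, $\Delta(e_i)=e_i\otimes1+\omega_i\otimes e_i$, $\Delta(f_i)=1\otimes f_i+f_i\otimes\omega_i'$. For $\mu=\sum k_i\alpha_i\in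 Q$: $\omega_\mu=\prod\omega_i^{k_i}$, $\omega'_\mu=\prod(\omega'_i)^{k_i}$. $U^+$, $U^-$ are the subalgebras generated by the $e_i$, resp. the $f_i$; $U^{\ge}$ by the $e_i,\omega_i^{\pm1}$; $U^{\le}$ by the $f_i,(\omega_i')^{\pm1}$; they are $Q$-graded with $\deg e_i=\alpha_i=-\deg f_i$, $\deg \omega_i=\deg\omega_i'=0$. **Pairing, $\Theta$, $\widetilde f$.** $(\cdot,\cdot)\colon U^{\le}\times U^{\ge}\to\mathbb K$ is the unique bilinear pairing with $(yy',x)=(y\otimes y',\Delta(x))$, $(y,xx')=(\Delta(y),x'\otimes x)$, $(f_i,\omega_j)=0=(\omega_i',e_j)$, $(f_i,e_j)=\delta_{ij}/(s_i-r_i)$, $(\omega'_\lambda,\omega_\mu)=r^{\langle\lambda,\mu\rangle}s^{-\langle\mu,\lambda\rangle}$ for $\lambda,\mu\in Q$; the last formula is also used as notation for $\lambda,\mu\in\bigoplus\mathbb Z\varepsilon_i$. For $\mu>0$ in $Q$ let $\{x_i^\mu\}$, $\{y_i^\mu\}$ be dual bases of $U^+_\mu$, $U^-_{-\mu}$, $\Theta_\mu=\sum_iy_i^\mu\otimes x_i^\mu$, $\Theta=1+\sum_{\mu>0}\Theta_\mu$ (acting on a tensor product of finite-dimensional modules by a finite sum). A vector $v$ has weight $\lambda$ if $\omega_iv=(\omega'_\lambda,\omega_i)v$ and $\omega'_iv=(\omega'_i,\omega_\lambda)^{-1}v$ for all $i$ (with $\omega_i=\omega_{\alpha_i}$, $\omega'_i=\omega'_{\alpha_i}$).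 $\widetilde f(v\otimes w)=f(\lambda,\mu)\,v\otimes w$ for $v,w$ of weights $\lambda,\mu$, where $f(\lambda,\mu)=(\omega'_\mu,\omega_\lambda)^{-1}=r^{-\langle\mu,\lambda\rangle}s^{\langle\lambda,\mu\rangle}$. $\tau(v\otimes w)=w\otimes v$. **Module.** $N=2n$, $i'=N+1-i$, $V=\mathbb K^{N}$ with basis $v_1,\dots,v_N$ and matrix units $E_{ij}v_k=\delta_{jk}v_i$. $v_k$ has weight $\varepsilon_k$, where $\varepsilon_{k'}=-\varepsilon_k$ for $k\le n$ (this determines the action of $\omega_i,\omega_i'$); $e_i=E_{i,i+1}-E_{(i+1)',i'}$ and $f_i=E_{i+1,i}-(rs)^{-1}E_{i',(i+1)'}$ for $i<n$; $e_n=(rs)^{-1}E_{n-1,n'}-E_{n,(n-1)'}$, $f_n=E_{n',n-1}-E_{(n-1)',n}$. In all sums indices run over $1,\dots,2n$ unless otherwise indicated. *)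

(* Defs.v *)
From HB Require Import structures.
From mathcomp Require Import all_boot all_order all_algebra.
From mathcomp.classical Require Import boolp classical_sets functions.
From mathcomp.classical Require Import cardinality fsbigop.
From mathcomp Require Import reals.
From mathcomp.multinomials Require Import monalg.
From mathcomp.real_closed Require Import complex mxtens.

Set Implicit Arguments.
Unset Strict Implicit.
Unset Printing Implicit Defensive.

Import Order.TTheory GRing.Theory Num.Theory.

Local Open Scope ring_scope.
Local Open Scope quotient_scope.
Local Open Scope classical_set_scope.

Section FreeAlgebra.
Context (K : fieldType) (X : choiceType).

Definition freealg := {malg K[{fmonom X}]}.

HB.instance Definition _ := GRing.Lalgebra.on freealg.

Fact freealg_scalerAr (c : K) (x y : freealg) : c *: (x * y) = x * (c *: y).
Proof.
have malgC_comm : x * c%:MP = c%:MP * x.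
  have -> : x * c%:MP = fgmul x << c *g mone >> by [].
  have -> : c%:MP * x = fgmul << c *g mone >> x by [].
  rewrite fgmulgU fgmulUg; apply: eq_bigr => k _.
  by rewrite mulrC mulm1 mul1m.
by rewrite -2!mul_malgC mulrA -malgC_comm -mulrA.
Qed.

HB.instance Definition _ :=
  GRing.Lalgebra_isAlgebra.Build K freealg freealg_scalerAr.

Definition freegen (x : X) : freealg := << fmu x >>.

End FreeAlgebra.

Section QuotientAlgebra.
Context (K : fieldType) (A : algType K) (S : set A).

Inductive ideal_of : A -> Prop :=
| ideal_of_sub x : S x -> ideal_of x
| ideal_of0 : ideal_of 0
| ideal_ofD x y : ideal_of x -> ideal_of y -> ideal_of (x + y)
| ideal_ofM a x b : ideal_of x -> ideal_of (a * x * b).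

Lemma ideal_ofMl a x : ideal_of x -> ideal_of (a * x).
Proof. by move=> /(ideal_ofM a 1); rewrite mulr1. Qed.

Lemma ideal_ofMr x b : ideal_of x -> ideal_of (x * b).
Proof. by move=> /(ideal_ofM 1 b); rewrite mul1r. Qed.

Lemma ideal_ofZ c x : ideal_of x -> ideal_of (c *: x).
Proof. by move=> /(ideal_ofMl c%:A); rewrite -scalerAl mul1r. Qed.

Lemma ideal_ofN x : ideal_of x -> ideal_of (- x).
Proof. by move=> /(ideal_ofZ (-1)); rewrite scaleN1r. Qed.

Definition ideal_cong (x y : A) := `[< ideal_of (x - y) >].

Lemma ideal_cong_equiv : equiv_class_of ideal_cong.
Proof.
split=> [x|x y|y x z].
- by apply/asboolP; rewrite subrr; exact: ideal_of0.
- by apply/asboolP/asboolP => /ideal_ofN; rewrite opprB.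
- move=> /asboolP xy /asboolP yz; apply/asboolP.
  by rewrite -(subrKA y); exact: ideal_ofD.
Qed.

Canonical ideal_cong_rel := EquivRelPack ideal_cong_equiv.

Definition quoalg := {eq_quot ideal_cong}.

HB.instance Definition _ := Choice.on quoalg.
HB.instance Definition _ := Quotient.on quoalg.
HB.instance Definition _ := EqQuotient.on quoalg.

Lemma quo_eqP (x y : A) : \pi_quoalg x = \pi_quoalg y <-> ideal_of (x - y).
Proof.
split; first by move/eqmodP/asboolP.
by move=> xy; apply/eqmodP/asboolP.
Qed.

Lemma quo_ind (P : quoalg -> Prop) :
  (forall x, P (\pi_quoalg x)) -> forall u, P u.
Proof. exact: quotW. Qed.

Lemma quo_repr (x : A) : ideal_of (repr (\pi_quoalg x) - x).
Proof. by apply/quo_eqP; rewrite reprK. Qed.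

Definition quo_add (u v : quoalg) := \pi_quoalg (repr u + repr v).
Definition quo_opp (u : quoalg) := \pi_quoalg (- repr u).
Definition quo_mul (u v : quoalg) := \pi_quoalg (repr u * repr v).
Definition quo_scale (c : K) (u : quoalg) := \pi_quoalg (c *: repr u).

Lemma pi_quo_add x y :
  quo_add (\pi_quoalg x) (\pi_quoalg y) = \pi_quoalg (x + y).
Proof.
apply/quo_eqP; rewrite opprD addrACA.
by apply: ideal_ofD; exact: quo_repr.
Qed.

Lemma pi_quo_opp x : quo_opp (\pi_quoalg x) = \pi_quoalg (- x).
Proof. by apply/quo_eqP; rewrite -opprD; apply/ideal_ofN/quo_repr. Qed.

Lemma pi_quo_mul x y :
  quo_mul (\pi_quoalg x) (\pi_quoalg y) = \pi_quoalg (x * y).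
Proof.
apply/quo_eqP; set x' := repr _; set y' := repr _.
have -> : x' * y' - x * y = (x' - x) * y' + x * (y' - y).
  by rewrite mulrBl mulrBr subrKA.
by apply: ideal_ofD; [apply: ideal_ofMr|apply: ideal_ofMl]; exact: quo_repr.
Qed.

Lemma pi_quo_scale c x : quo_scale c (\pi_quoalg x) = \pi_quoalg (c *: x).
Proof. by apply/quo_eqP; rewrite -scalerBr; apply/ideal_ofZ/quo_repr. Qed.

Fact quo_addA : associative quo_add.
Proof.
move=> u v w; elim/quo_ind: u => x; elim/quo_ind: v => y.
by elim/quo_ind: w => z; rewrite !pi_quo_add addrA.
Qed.

Fact quo_addC : commutative quo_add.
Proof. by move=> u v; elim/quo_ind: u => x; elim/quo_ind: v => y; rewrite !pi_quo_add addrC. Qed.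

Fact quo_add0 : left_id (\pi_quoalg 0) quo_add.
Proof. by move=> u; elim/quo_ind: u => x; rewrite !pi_quo_add add0r. Qed.

Fact quo_addN : left_inverse (\pi_quoalg 0) quo_opp quo_add.
Proof. by move=> u; elim/quo_ind: u => x; rewrite pi_quo_opp pi_quo_add addNr. Qed.

HB.instance Definition _ :=
  GRing.isZmodule.Build quoalg quo_addA quo_addC quo_add0 quo_addN.

Fact quo_mulA : associative quo_mul.
Proof.
move=> u v w; elim/quo_ind: u => x; elim/quo_ind: v => y.
by elim/quo_ind: w => z; rewrite !pi_quo_mul mulrA.
Qed.

Fact quo_mul1l : left_id (\pi_quoalg 1) quo_mul.
Proof. by move=> u; elim/quo_ind: u => x; rewrite pi_quo_mul mul1r. Qed.

Fact quo_mul1r : right_id (\pi_quoalg 1) quo_mul.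
Proof. by move=> u; elim/quo_ind: u => x; rewrite pi_quo_mul mulr1. Qed.

Fact quo_mulDl : left_distributive quo_mul quo_add.
Proof.
move=> u v w; elim/quo_ind: u => x; elim/quo_ind: v => y.
elim/quo_ind: w => z.
by rewrite !(pi_quo_mul, pi_quo_add) mulrDl.
Qed.

Fact quo_mulDr : right_distributive quo_mul quo_add.
Proof.
move=> u v w; elim/quo_ind: u => x; elim/quo_ind: v => y.
elim/quo_ind: w => z.
by rewrite !(pi_quo_mul, pi_quo_add) mulrDr.
Qed.

HB.instance Definition _ := GRing.Zmodule_isPzRing.Build quoalg
  quo_mulA quo_mul1l quo_mul1r quo_mulDl quo_mulDr.

Fact quo_scaleA c d u : quo_scale c (quo_scale d u) = quo_scale (c * d) u.
Proof. by elim/quo_ind: u => x; rewrite !pi_quo_scale scalerA. Qed.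

Fact quo_scale1 : left_id 1 quo_scale.
Proof. by move=> u; elim/quo_ind: u => x; rewrite pi_quo_scale scale1r. Qed.

Fact quo_scaleDr : right_distributive quo_scale +%R.
Proof.
move=> c; move=> u v; elim/quo_ind: u => x; elim/quo_ind: v => y.
by rewrite /GRing.add /= !(pi_quo_scale, pi_quo_add) scalerDr.
Qed.

Fact quo_scaleDl u : {morph quo_scale^~ u : a b / a + b}.
Proof.
move=> a b; elim/quo_ind: u => x.
by rewrite /GRing.add /= !(pi_quo_scale, pi_quo_add) scalerDl.
Qed.

HB.instance Definition _ := GRing.Zmodule_isLmodule.Build K quoalg
  quo_scaleA quo_scale1 quo_scaleDr quo_scaleDl.

Lemma quo_scalerAl (c : K) (u v : quoalg) : c *: (u * v) = (c *: u) * v.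
Proof.
elim/quo_ind: u => x; elim/quo_ind: v => y.
by rewrite /GRing.scale /GRing.mul /= !(pi_quo_scale, pi_quo_mul) scalerAl.
Qed.

Lemma quo_scalerAr (c : K) (u v : quoalg) : c *: (u * v) = u * (c *: v).
Proof.
elim/quo_ind: u => x; elim/quo_ind: v => y.
by rewrite /GRing.scale /GRing.mul /= !(pi_quo_scale, pi_quo_mul) scalerAr.
Qed.

End QuotientAlgebra.

Section Tensor.
Context (K : fieldType) (A B : lmodType K).

Definition is_bilinear (M : lmodType K) (f : A -> B -> M) : Prop :=
  (forall b, linear (f^~ b)) /\ (forall a, linear (f a)).

Definition bsum (M : lmodType K) (f : A -> B -> M) (l : seq (A * B)) : M :=
  \sum_(p <- l) f p.1 p.2.

(* A formal sum l of pairs represents \sum_(p <- l) p.1 (x) p.2; two formal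
   sums agree in the tensor product iff no bilinear map separates them. *)
Definition tensor_cong (l1 l2 : seq (A * B)) :=
  `[< forall (M : lmodType K) (f : A -> B -> M),
        is_bilinear f -> bsum f l1 = bsum f l2 >].

Lemma tensor_cong_equiv : equiv_class_of tensor_cong.
Proof.
split=> [l|l1 l2|l2 l1 l3].
- exact/asboolP.
- by apply/asboolP/asboolP => h M f bf; rewrite h.
- by move=> /asboolP h12 /asboolP h23; apply/asboolP => M f bf; rewrite h12 ?h23.
Qed.

Canonical tensor_cong_rel := EquivRelPack tensor_cong_equiv.

Definition tensor := {eq_quot tensor_cong}.

HB.instance Definition _ := Choice.on tensor.
HB.instance Definition _ := Quotient.on tensor.
HB.instance Definition _ := EqQuotient.on tensor.

Lemma tensor_eqP (l1 l2 : seq (A * B)) :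
  \pi_tensor l1 = \pi_tensor l2 <->
  forall (M : lmodType K) (f : A -> B -> M),
    is_bilinear f -> bsum f l1 = bsum f l2.
Proof.
split; first by move/eqmodP/asboolP.
by move=> h; apply/eqmodP/asboolP.
Qed.

Lemma tensor_pi_ind (P : tensor -> Prop) :
  (forall l, P (\pi_tensor l)) -> forall t, P t.
Proof. exact: quotW. Qed.

Definition tensor_lift (M : lmodType K) (f : A -> B -> M) (t : tensor) : M :=
  bsum f (repr t).

Lemma pi_tensor_lift (M : lmodType K) (f : A -> B -> M) l :
  is_bilinear f -> tensor_lift f (\pi_tensor l) = bsum f l.
Proof.
move=> bf; apply: (tensor_eqP _ _).1 bf.
by rewrite reprK.
Qed.

Definition tscale (c : K) (l : seq (A * B)) := [seq (c *: p.1, p.2) | p <- l].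

Lemma bsum_cat (M : lmodType K) (f : A -> B -> M) l1 l2 :
  bsum f (l1 ++ l2) = bsum f l1 + bsum f l2.
Proof. by rewrite /bsum big_cat. Qed.

Lemma bsum_scale (M : lmodType K) (f : A -> B -> M) c l :
  is_bilinear f -> bsum f (tscale c l) = c *: bsum f l.
Proof.
move=> [lf _]; rewrite /bsum big_map scaler_sumr; apply: eq_bigr => p _ /=.
have f0 : f 0 p.2 = 0.
  by have := lf p.2 (-1) 0 0; rewrite /= scaler0 addr0 scaleN1r addNr.
by have := lf p.2 c p.1 0; rewrite /= f0 !addr0.
Qed.

Definition tensor_add (t u : tensor) := \pi_tensor (repr t ++ repr u).
Definition tensor_scale (c : K) (t : tensor) := \pi_tensor (tscale c (repr t)).
Definition tensor_opp (t : tensor) := tensor_scale (-1) t.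

Lemma pi_tensor_add l1 l2 :
  tensor_add (\pi_tensor l1) (\pi_tensor l2) = \pi_tensor (l1 ++ l2).
Proof.
apply/tensor_eqP => M f bf; rewrite !bsum_cat.
by rewrite -!/(tensor_lift _ _) !pi_tensor_lift.
Qed.

Lemma pi_tensor_scale c l :
  tensor_scale c (\pi_tensor l) = \pi_tensor (tscale c l).
Proof.
apply/tensor_eqP => M f bf; rewrite !bsum_scale //.
by rewrite -!/(tensor_lift _ _) !pi_tensor_lift.
Qed.

Fact tensor_addA : associative tensor_add.
Proof.
move=> u v w; elim/tensor_pi_ind: u => x; elim/tensor_pi_ind: v => y.
elim/tensor_pi_ind: w => z.
by rewrite !pi_tensor_add catA.
Qed.

Fact tensor_addC : commutative tensor_add.
Proof.
move=> u v; elim/tensor_pi_ind: u => x; elim/tensor_pi_ind: v => y; rewrite !pi_tensor_add.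
by apply/tensor_eqP => M f bf; rewrite !bsum_cat addrC.
Qed.

Fact tensor_add0 : left_id (\pi_tensor [::]) tensor_add.
Proof. by move=> u; elim/tensor_pi_ind: u => x; rewrite !pi_tensor_add. Qed.

Fact tensor_addN : left_inverse (\pi_tensor [::]) tensor_opp tensor_add.
Proof.
move=> u; elim/tensor_pi_ind: u => x; rewrite /tensor_opp pi_tensor_scale pi_tensor_add.
apply/tensor_eqP => M f bf.
by rewrite bsum_cat bsum_scale // scaleN1r addNr /bsum big_nil.
Qed.

HB.instance Definition _ := GRing.isZmodule.Build tensor
  tensor_addA tensor_addC tensor_add0 tensor_addN.

Lemma tensor_piD l1 l2 :
  \pi_tensor l1 + \pi_tensor l2 = \pi_tensor (l1 ++ l2).
Proof. exact: pi_tensor_add. Qed.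

Fact tensor_scaleA c d t :
  tensor_scale c (tensor_scale d t) = tensor_scale (c * d) t.
Proof.
elim/tensor_pi_ind: t => x; rewrite !pi_tensor_scale.
by apply/tensor_eqP => M f bf; rewrite !bsum_scale // scalerA.
Qed.

Fact tensor_scale1 : left_id 1 tensor_scale.
Proof.
move=> u; elim/tensor_pi_ind: u => x; rewrite pi_tensor_scale.
by apply/tensor_eqP => M f bf; rewrite !bsum_scale // scale1r.
Qed.

Fact tensor_scaleDr : right_distributive tensor_scale +%R.
Proof.
move=> c; move=> u v; elim/tensor_pi_ind: u => x; elim/tensor_pi_ind: v => y.
rewrite /GRing.add /= !(pi_tensor_scale, pi_tensor_add).
by rewrite /tscale map_cat.
Qed.

Fact tensor_scaleDl t : {morph tensor_scale^~ t : a b / a + b}.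
Proof.
move=> a b; elim/tensor_pi_ind: t => x.
rewrite [RHS]/GRing.add /= !(pi_tensor_scale, pi_tensor_add).
by apply/tensor_eqP => M f bf; rewrite bsum_cat !bsum_scale // scalerDl.
Qed.

HB.instance Definition _ := GRing.Zmodule_isLmodule.Build K tensor
  tensor_scaleA tensor_scale1 tensor_scaleDr tensor_scaleDl.

Definition tens (a : A) (b : B) : tensor := \pi_tensor [:: (a, b)].

Lemma tens_bilinear : is_bilinear tens.
Proof.
split=> [b c x y|a c x y]; rewrite /GRing.add /GRing.scale /= /tens;
  rewrite pi_tensor_scale pi_tensor_add; apply/tensor_eqP => M f bf;
  rewrite bsum_cat bsum_scale // /bsum !big_seq1 /=;
  [exact: bf.1|exact: bf.2].
Qed.

Lemma tensor_lift_tens (M : lmodType K) (f : A -> B -> M) a b :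
  is_bilinear f -> tensor_lift f (tens a b) = f a b.
Proof. by move=> bf; rewrite pi_tensor_lift // /bsum big_seq1. Qed.

Lemma tensor_lift_linear (M : lmodType K) (f : A -> B -> M) :
  is_bilinear f -> linear (tensor_lift f).
Proof.
move=> bf c; move=> u v; elim/tensor_pi_ind: u => x; elim/tensor_pi_ind: v => y.
rewrite [in LHS]/GRing.add /= [in LHS]/GRing.scale /=.
by rewrite pi_tensor_scale pi_tensor_add !pi_tensor_lift // bsum_cat bsum_scale.
Qed.

Lemma pi_tensor_sum (l : seq (A * B)) :
  \pi_tensor l = \sum_(p <- l) tens p.1 p.2.
Proof.
elim: l => [|[a b] l IHl]; first by rewrite big_nil.
by rewrite big_cons -IHl /GRing.add /= pi_tensor_add.
Qed.

End Tensor.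

Section TensorAlgebra.
Context (K : fieldType) (A B : algType K).
Local Notation T := (tensor A B).

Definition tmul (l1 l2 : seq (A * B)) : seq (A * B) :=
  [seq (p.1 * q.1, p.2 * q.2) | p <- l1, q <- l2].

Lemma bsum_mul (M : lmodType K) (f : A -> B -> M) l1 l2 :
  bsum f (tmul l1 l2) =
  \sum_(p <- l1) \sum_(q <- l2) f (p.1 * q.1) (p.2 * q.2).
Proof. by rewrite /bsum big_allpairs_dep. Qed.

Definition tensor_mul (t u : T) : T := \pi_T (tmul (repr t) (repr u)).

Lemma pi_tensor_mul l1 l2 :
  tensor_mul (\pi_T l1) (\pi_T l2) = \pi_T (tmul l1 l2).
Proof.
apply/tensor_eqP => M f [bl br]; rewrite !bsum_mul.
have linl q : is_bilinear (fun a b => f (a * q.1) (b * q.2)).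
  split=> [b c x y|a c x y] /=; first by rewrite mulrDl -scalerAl bl.
  by rewrite mulrDl -scalerAl br.
have linr p : is_bilinear (fun a b => f (p.1 * a) (p.2 * b)).
  split=> [b c x y|a c x y] /=; first by rewrite mulrDr -scalerAr bl.
  by rewrite mulrDr -scalerAr br.
transitivity (\sum_(p <- repr (\pi_T l1)) \sum_(q <- l2)
                f (p.1 * q.1) (p.2 * q.2)).
  by apply: eq_bigr => p _; exact: (pi_tensor_lift l2 (linr p)).
rewrite exchange_big [RHS]exchange_big; apply: eq_bigr => q _.
exact: (pi_tensor_lift l1 (linl q)).
Qed.

Fact tensor_mulA : associative tensor_mul.
Proof.
move=> u v w; elim/(@tensor_pi_ind K A B): u => x.
elim/(@tensor_pi_ind K A B): v => y; elim/(@tensor_pi_ind K A B): w => z; rewrite !pi_tensor_mul.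
apply/tensor_eqP => M f bf; rewrite !bsum_mul big_allpairs_dep /=.
apply: eq_bigr => p _; rewrite big_allpairs_dep /=; apply: eq_bigr => q _.
by apply: eq_bigr => s _; rewrite !mulrA.
Qed.

Fact tensor_mul1l : left_id (tens 1 1) tensor_mul.
Proof.
move=> u; elim/(@tensor_pi_ind K A B): u => x; rewrite pi_tensor_mul; apply/tensor_eqP => M f bf.
by rewrite bsum_mul big_seq1; apply: eq_bigr => p _; rewrite !mul1r.
Qed.

Fact tensor_mul1r : right_id (tens 1 1) tensor_mul.
Proof.
move=> u; elim/(@tensor_pi_ind K A B): u => x; rewrite pi_tensor_mul; apply/tensor_eqP => M f bf.
by rewrite bsum_mul; apply: eq_bigr => p _; rewrite big_seq1 !mulr1.
Qed.

Fact tensor_mulDl : left_distributive tensor_mul +%R.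
Proof.
move=> u v w; elim/(@tensor_pi_ind K A B): u => x.
elim/(@tensor_pi_ind K A B): v => y; elim/(@tensor_pi_ind K A B): w => z.
rewrite tensor_piD !pi_tensor_mul tensor_piD.
by apply/tensor_eqP => M f bf; rewrite bsum_cat !bsum_mul big_cat.
Qed.

Fact tensor_mulDr : right_distributive tensor_mul +%R.
Proof.
move=> u v w; elim/(@tensor_pi_ind K A B): u => x.
elim/(@tensor_pi_ind K A B): v => y; elim/(@tensor_pi_ind K A B): w => z.
rewrite tensor_piD !pi_tensor_mul tensor_piD.
apply/tensor_eqP => M f bf; rewrite bsum_cat !bsum_mul -big_split /=.
by apply: eq_bigr => p _; rewrite big_cat.
Qed.

HB.instance Definition _ := GRing.Zmodule_isPzRing.Build T
  tensor_mulA tensor_mul1l tensor_mul1r tensor_mulDl tensor_mulDr.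

Lemma tensM (a a' : A) (b b' : B) :
  tens a b * tens a' b' = tens (a * a') (b * b').
Proof. by rewrite /GRing.mul /= /tens pi_tensor_mul. Qed.

End TensorAlgebra.

Section Spans.
Context (K : fieldType) (A : algType K).

Inductive lspan (S : set A) : A -> Prop :=
| lspan_sub x : S x -> lspan S x
| lspan0 : lspan S 0
| lspanP c x y : lspan S x -> lspan S y -> lspan S (c *: x + y).

Inductive subalg (S : set A) : A -> Prop :=
| subalg_sub x : S x -> subalg S x
| subalg1 : subalg S 1
| subalgP c x y : subalg S x -> subalg S y -> subalg S (c *: x + y)
| subalgM x y : subalg S x -> subalg S y -> subalg S (x * y).

Definition is_basis (V : set A) (d : nat) (b : 'I_d -> A) : Prop :=
  (forall i, V (b i)) /\
  (forall v, V v -> exists! c : 'rV[K]_d, v = \sum_i c 0 i *: b i).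

End Spans.

(* Root data of type D_n. Indices are 0-based: the simple root alpha_(i+1)
   is alpha i for i : 'I_n. Weights are the integral combinations of the eps_i;
   elements of Q are given by their coordinates in the simple roots. *)
Section RootData.
Context (n : nat).

Definition alpha (i : 'I_n) : 'rV[int]_n :=
  \row_(j < n) if (i.+1 < n)%N then (j == i)%:R - (j == i.+1 :> nat)%:R
         else (j.+1 == i :> nat)%:R + (j == i)%:R.

Definition dotp (l m : 'rV[int]_n) : int := \sum_i l 0 i * m 0 i.

Definition cartan (i j : 'I_n) : int :=
  ((2 * dotp (alpha i) (alpha j)) %/ dotp (alpha i) (alpha i))%Z.

(* Twice the (1/2)Z-valued form <l, m>. *)
Definition form2 (l m : 'rV[int]_n) : int :=
  \sum_(i < n) \sum_(j < n) (if (i < j)%N then -1 else 1) * l 0 i * m 0 j.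

Definition root_of (k : 'rV[int]_n) : 'rV[int]_n := \sum_i k 0 i *: alpha i.

Definition Qpos (k : 'rV[int]_n) : Prop := k != 0 /\ forall i, 0 <= k 0 i.

End RootData.

Inductive gen_kind := KE | KF | KW | KWV | KW' | KWV'.

Definition nat_of_kind (k : gen_kind) : nat :=
  match k with KE => 0 | KF => 1 | KW => 2 | KWV => 3 | KW' => 4 | KWV' => 5 end.

Definition kind_of_nat (m : nat) : option gen_kind :=
  nth None [:: Some KE; Some KF; Some KW; Some KWV; Some KW'; Some KWV'] m.

Fact nat_of_kindK : pcancel nat_of_kind kind_of_nat.
Proof. by case. Qed.

HB.instance Definition _ := Choice.copy gen_kind (pcan_type nat_of_kindK).

Section QuantumGroup.
(* rh and sh are the fixed square roots of r and s. *)
Context (K : fieldType) (rh sh : K) (n : nat).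

Let r := rh ^+ 2.
Let s := sh ^+ 2.

(* rpow l m = r^<l,m> and spow l m = s^<l,m>. *)
Definition rpow (l m : 'rV[int]_n) : K := rh ^ form2 l m.
Definition spow (l m : 'rV[int]_n) : K := sh ^ form2 l m.

Definition qint (m : nat) : K := (r ^+ m - s ^+ m) / (r - s).
Definition qfact (m : nat) : K := \prod_(1 <= i < m.+1) qint i.
Definition qbinom (m k : nat) : K := qfact m / (qfact (m - k) * qfact k).

Definition gen : choiceType := (gen_kind * 'I_n)%type.

Definition toral (g : gen) : bool :=
  match g.1 with KE | KF => false | _ => true end.

Local Notation F := (freealg K gen).
Local Notation X k i := (freegen K ((k, i) : gen)).

(* (rs)^<l,m> is the power of (rs)^(1/2) = rh * sh of exponent 2<l,m>. *)
Definition serre_coef (i j : 'I_n) (m k : nat) : K :=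
  (-1) ^+ k * qbinom m k * (r * s) ^+ (k * k.-1)./2 *
  (rh * sh) ^ (k%:Z * form2 (alpha j) (alpha i)).

Inductive urs_rel : F -> Prop :=
| rel_toral g h : toral g -> toral h ->
    urs_rel (freegen K g * freegen K h - freegen K h * freegen K g)
| rel_wV i : urs_rel (X KW i * X KWV i - 1)
| rel_w'V i : urs_rel (X KW' i * X KWV' i - 1)
| rel_we i j : urs_rel (X KW i * X KE j -
    (rpow (alpha j) (alpha i) * (spow (alpha i) (alpha j))^-1)
      *: (X KE j * X KW i))
| rel_wf i j : urs_rel (X KW i * X KF j -
    ((rpow (alpha j) (alpha i))^-1 * spow (alpha i) (alpha j))
      *: (X KF j * X KW i))
| rel_w'e i j : urs_rel (X KW' i * X KE j -
    ((rpow (alpha i) (alpha j))^-1 * spow (alpha j) (alpha i))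
      *: (X KE j * X KW' i))
| rel_w'f i j : urs_rel (X KW' i * X KF j -
    (rpow (alpha i) (alpha j) * (spow (alpha j) (alpha i))^-1)
      *: (X KF j * X KW' i))
| rel_ef i j : urs_rel (X KE i * X KF j - X KF j * X KE i -
    (if i == j then (r - s)^-1 *: (X KW i - X KW' i) else 0))
| rel_serre_e i j (m := `|1 - cartan i j|%N) : i != j ->
    urs_rel (\sum_(0 <= k < m.+1) serre_coef i j m k
               *: (X KE i ^+ (m - k) * X KE j * X KE i ^+ k))
| rel_serre_f i j (m := `|1 - cartan i j|%N) : i != j ->
    urs_rel (\sum_(0 <= k < m.+1) serre_coef i j m k
               *: (X KF i ^+ k * X KF j * X KF i ^+ (m - k))).

Definition Urs := quoalg urs_rel.

HB.instance Definition _ := GRing.PzRing.on Urs.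
HB.instance Definition _ := GRing.Lmodule.on Urs.

(* The counit, on the free algebra: it shows that Urs is not the zero ring. *)
Definition counit_gen (g : gen) : K := (toral g)%:R.
Definition counit_mon (m : {fmonom gen}) : K := \prod_(g <- m) counit_gen g.

Fact counit_mon_mmorphism : mmorphism counit_mon.
Proof.
split=> [x y|]; first by rewrite /counit_mon fmM big_cat.
by rewrite /counit_mon fm1 big_nil.
Qed.

HB.instance Definition _ :=
  monalg.isMultiplicative.Build {fmonom gen} K counit_mon counit_mon_mmorphism.

Definition counit_free (x : F) : K := mmap (@idfun K) counit_mon x.

Local Notation cf := counit_free.

Lemma counit_freeD : {morph cf : x y / x + y}.
Proof. exact: mmapD. Qed.

Lemma counit_freeB : {morph cf : x y / x - y}.
Proof. exact: mmapB. Qed.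

Lemma counit_free0 : cf 0 = 0.
Proof. exact: mmap0. Qed.

Lemma counit_freeM : {morph cf : x y / x * y}.
Proof. exact: (mmap_is_multiplicative (f := idfun) (h := counit_mon)).1. Qed.

Lemma counit_free1 : cf 1 = 1.
Proof. exact: (mmap_is_multiplicative (f := idfun) (h := counit_mon)).2. Qed.

Lemma counit_freeZ c x : cf (c *: x) = c * cf x.
Proof. exact: (mmap_is_linear (h := counit_mon)). Qed.

Lemma counit_free_gen g : cf (freegen K g) = (toral g)%:R.
Proof.
rewrite /counit_free /freegen mmapU /= mul1r.
by rewrite /counit_mon fmU big_seq1.
Qed.

Lemma counit_ideal x : ideal_of urs_rel x -> cf x = 0.
Proof.
elim=> {x} [x|//|x y _ cx _ cy|a x b _ cx].
- have cE := (counit_freeB, counit_freeM, counit_freeZ, counit_free1,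
              counit_free_gen, counit_free0).
  have cS (f h : nat -> F) (m : nat) (c : nat -> K) j k :
      ~~ toral (k, j) ->
      cf (\sum_(0 <= i < m) c i *: (f i * X k j * h i)) = 0.
    move=> /negbTE kj; rewrite (big_morph cf counit_freeD counit_free0).
    by apply: big1 => i _; rewrite !cE kj mulr0 mul0r mulr0.
  case=> [g h tg th|i|i|i j|i j|i j|i j|i j|i j m _|i j m _];
    rewrite ?cE /= ?(mulr0, mul0r, mulr1, subrr) //.
  + by rewrite tg th subrr.
  + by case: (i == j); rewrite !cE ?(subrr, mulr0).
  + exact: cS.
  + exact: cS.
- exact: counit_free0.
- by rewrite counit_freeD cx cy addr0.
- by rewrite !counit_freeM cx mulr0 mul0r.
Qed.

Fact Urs_oner_neq0 : (1 : Urs) != 0.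
Proof.
apply/eqP => /quo_eqP; rewrite subr0 => /counit_ideal /eqP.
by rewrite counit_free1 oner_eq0.
Qed.

HB.instance Definition _ :=
  GRing.PzSemiRing_isNonZero.Build Urs Urs_oner_neq0.

Fact Urs_scalerAl (c : K) (u v : Urs) : c *: (u * v) = (c *: u) * v.
Proof. exact: quo_scalerAl. Qed.

HB.instance Definition _ := GRing.Lmodule_isLalgebra.Build K Urs Urs_scalerAl.

Fact Urs_scalerAr (c : K) (u v : Urs) : c *: (u * v) = u * (c *: v).
Proof. exact: quo_scalerAr. Qed.

HB.instance Definition _ := GRing.Lalgebra_isAlgebra.Build K Urs Urs_scalerAr.

Definition ugen (k : gen_kind) (i : 'I_n) : Urs := \pi_Urs (X k i).

Local Notation ue := (ugen KE).
Local Notation uf := (ugen KF).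
Local Notation uw := (ugen KW).
Local Notation uwV := (ugen KWV).
Local Notation uw' := (ugen KW').
Local Notation uw'V := (ugen KWV').

Definition zpow (x xV : Urs) (m : int) : Urs :=
  match m with Posz p => x ^+ p | Negz p => xV ^+ p.+1 end.

(* omega_mu and omega'_mu for mu in Q. *)
Definition omegaQ (k : 'rV[int]_n) : Urs :=
  \prod_(i < n) zpow (uw i) (uwV i) (k 0 i).
Definition omega'Q (k : 'rV[int]_n) : Urs :=
  \prod_(i < n) zpow (uw' i) (uw'V i) (k 0 i).

Definition Uge : set Urs :=
  subalg (range ue `|` range uw `|` range uwV).
Definition Ule : set Urs :=
  subalg (range uf `|` range uw' `|` range uw'V).

(* U^+_mu and U^-_{-mu}: spanned by the monomials of degree mu (resp. -mu). *)
Definition content (l : seq 'I_n) : 'rV[int]_n := \sum_(i <- l) delta_mx 0 i.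
Definition Uplus (mu : 'rV[int]_n) : set Urs :=
  lspan [set \prod_(i <- l) ue i | l in [set l | content l = mu]].
Definition Uminus (mu : 'rV[int]_n) : set Urs :=
  lspan [set \prod_(i <- l) uf i | l in [set l | content l = mu]].

Record is_coproduct (Delta : {lrmorphism Urs -> tensor Urs Urs}) : Prop := {
  coproduct_w i : Delta (uw i) = tens (uw i) (uw i);
  coproduct_w' i : Delta (uw' i) = tens (uw' i) (uw' i);
  coproduct_e i : Delta (ue i) = tens (ue i) 1 + tens (uw i) (ue i);
  coproduct_f i : Delta (uf i) = tens 1 (uf i) + tens (uf i) (uw' i)
}.

(* (omega'_l, omega_m), for weights l and m. *)
Definition wpair (l m : 'rV[int]_n) : K := rpow l m * (spow m l)^-1.

(* B is only meaningful on U^<= x U^>=. An equation (y (x) y', Delta x) = _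
   is stated through the presentations of Delta x in U^>= (x) U^>=. *)
Record is_pairing (Delta : {lrmorphism Urs -> tensor Urs Urs})
    (B : Urs -> Urs -> K) : Prop := {
  pairing_linl c y y' x : Ule y -> Ule y' -> Uge x ->
    B (c *: y + y') x = c * B y x + B y' x;
  pairing_linr c y x x' : Ule y -> Uge x -> Uge x' ->
    B y (c *: x + x') = c * B y x + B y x';
  pairing_mull y y' x (l : seq (Urs * Urs)) : Ule y -> Ule y' -> Uge x ->
    (forall p, p \in l -> Uge p.1 /\ Uge p.2) ->
    Delta x = \sum_(p <- l) tens p.1 p.2 ->
    B (y * y') x = \sum_(p <- l) B y p.1 * B y' p.2;
  pairing_mulr y x x' (l : seq (Urs * Urs)) : Ule y -> Uge x -> Uge x' ->
    (forall p, p \in l -> Ule p.1 /\ Ule p.2) ->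
    Delta y = \sum_(p <- l) tens p.1 p.2 ->
    B y (x * x') = \sum_(p <- l) B p.1 x' * B p.2 x;
  pairing_fw i j : B (uf i) (uw j) = 0;
  pairing_w'e i j : B (uw' i) (ue j) = 0;
  pairing_fe i j : B (uf i) (ue j) = (i == j)%:R / (s - r);
  pairing_w'w k l :
    B (omega'Q k) (omegaQ l) = wpair (root_of k) (root_of l)
}.

Definition are_dual_bases (B : Urs -> Urs -> K) (d : 'rV[int]_n -> nat)
    (x y : forall mu, 'I_(d mu) -> Urs) : Prop :=
  forall mu, Qpos mu ->
    [/\ is_basis (Uplus mu) (x mu), is_basis (Uminus mu) (y mu) &
        forall i j, B (y mu i) (x mu j) = (i == j)%:R].

Definition Theta_part (d : 'rV[int]_n -> nat)
    (x y : forall mu, 'I_(d mu) -> Urs) (mu : 'rV[int]_n) : tensor Urs Urs :=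
  \sum_(i < d mu) tens (y mu i) (x mu i).

(* The module V: an operator is the matrix of its action on column vectors,
   v_(k+1) is the column delta_mx k 0 for k : 'I_(2n), and k' is rev_ord k. *)
Local Notation N := (2 * n)%N.

Definition vbasis_ (k : 'I_N) : 'cV[K]_N := delta_mx k 0.

(* The matrix unit at 0-based positions (a, b), and a'. *)
Definition Emx (a b : nat) : 'M[K]_N :=
  \matrix_(i < N, j < N) ((i == a :> nat) && (j == b :> nat))%:R.
Definition pr (a : nat) : nat := (N - a.+1)%N.

Definition epsV (k : 'I_N) : 'rV[int]_n :=
  \row_(j < n) ((j == k :> nat)%:R - (j == pr k :> nat)%:R).

Definition has_weight (rho : {lrmorphism Urs -> 'M[K]_N}) (l : 'rV[int]_n)
    (v : 'cV[K]_N) : Prop :=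
  forall i, rho (uw i) *m v = wpair l (alpha i) *: v /\
            rho (uw' i) *m v = (wpair (alpha i) l)^-1 *: v.

Record is_fundamental (rho : {lrmorphism Urs -> 'M[K]_N}) : Prop := {
  fundamental_weight k : has_weight rho (epsV k) (vbasis_ k);
  fundamental_e (i : 'I_n) : rho (ue i) =
    if (i.+1 < n)%N then Emx i i.+1 - Emx (pr i.+1) (pr i)
    else (r * s)^-1 *: Emx i.-1 (pr i) - Emx i (pr i.-1);
  fundamental_f (i : 'I_n) : rho (uf i) =
    if (i.+1 < n)%N then Emx i.+1 i - (r * s)^-1 *: Emx (pr i) (pr i.+1)
    else Emx (pr i) i.-1 - Emx (pr i.-1) i
}.

Definition act2 (rho : {lrmorphism Urs -> 'M[K]_N}) :
    tensor Urs Urs -> 'M[K]_(N * N) :=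
  tensor_lift (fun u v : Urs => rho u *t rho v).

Lemma act2_tens (rho : {lrmorphism Urs -> 'M[K]_N}) (u v : Urs) :
  act2 rho (tens u v) = rho u *t rho v.
Proof.
apply: tensor_lift_tens; split=> [b c x y|a c x y] /=; rewrite linearP.
  by apply/matrixP => i j; rewrite !mxE mulrDl mulrA.
by apply/matrixP => i j; rewrite !mxE mulrDr mulrCA.
Qed.

(* Only finitely many Theta_mu act nontrivially on V (x) V, so that the sum over
   mu > 0, taken over its finite support, is the action of Theta. *)
Definition Theta_act (rho : {lrmorphism Urs -> 'M[K]_N})
    (d : 'rV[int]_n -> nat) (x y : forall mu, 'I_(d mu) -> Urs) :
    'M[K]_(N * N) :=
  1%:M + \sum_(mu \in [set mu | Qpos mu]) act2 rho (Theta_part x y mu).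

(* v_(k+1) (x) v_(l+1) is scaled by f(lam, mu) = (omega'_mu, omega_lam)^-1, where
   lam and mu are the weights of its factors. *)
Definition ftilde : 'M[K]_(N * N) :=
  \sum_(k < N) \sum_(l < N)
    (wpair (epsV l) (epsV k))^-1 *: (delta_mx k k *t delta_mx l l).

Definition flip : 'M[K]_(N * N) :=
  \sum_(k < N) \sum_(l < N) delta_mx l k *t delta_mx k l.

Lemma flip_tens (k l : 'I_N) :
  flip *m (vbasis_ k *t vbasis_ l) = vbasis_ l *t vbasis_ k.
Proof.
rewrite /flip mulmx_suml (bigD1 k) //= mulmx_suml (bigD1 l) //=.
rewrite tensmx_mul !mul_delta_mx big1 ?addr0 => [|l' l'l]; last first.
  by rewrite tensmx_mul mul_delta_mx mul_delta_mx_0 ?tensmx0 // eq_sym.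
rewrite big1 ?addr0 // => k' k'k; rewrite mulmx_suml big1 // => l' _.
by rewrite tensmx_mul mul_delta_mx_0 ?tens0mx // eq_sym.
Qed.

Definition RVV (rho : {lrmorphism Urs -> 'M[K]_N})
    (d : 'rV[int]_n -> nat) (x y : forall mu, 'I_(d mu) -> Urs) :
    'M[K]_(N * N) :=
  Theta_act rho x y *m ftilde *m flip.

Definition sigma (i : 'I_N) : int := if (i < n)%N then 1 else -1.

(* Used for j != i, i' only, where the four cases are exhaustive. *)
Definition acoef (i j : 'I_N) : K :=
  let i' := rev_ord i in let j' := rev_ord j in
  if ((i < j) && (i < j') || (j < i) && (j' < i))%N
  then (rh * sh) ^ (- (sigma i * sigma j))
  else (rh * sh) ^ (sigma i * sigma j).

(* The 1-based index is i + 1, hence the exponents i + 1 - n and n - i. *)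
Definition tcoef (i : 'I_N) : K :=
  if (i < n)%N then s ^ (i.+1%:Z - n%:Z) else r ^ (n%:Z - i%:Z).

Definition Rhat : 'M[K]_(N * N) :=
  (rh^-1 * sh) *: (\sum_(i < N) delta_mx i i *t delta_mx i i)
  + (rh * sh^-1) *:
      (\sum_(i < N) delta_mx i (rev_ord i) *t delta_mx (rev_ord i) i)
  + \sum_(i < N) \sum_(j < N | (j != i) && (j != rev_ord i))
      acoef i j *: (delta_mx i j *t delta_mx j i)
  + ((s - r) / (rh * sh)) *:
      (\sum_(i < N | (i < n)%N)
        (1 - r ^+ (n - i.+1) * s ^- (n - i.+1))
          *: (delta_mx (rev_ord i) (rev_ord i) *t delta_mx i i))
  + ((s - r) / (rh * sh)) *:
      (\sum_(i < N) \sum_(j < N | (j < i)%N && (j != rev_ord i))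
        delta_mx i i *t delta_mx j j)
  + ((r - s) / (rh * sh)) *:
      (\sum_(i < N) \sum_(j < N | (i < j)%N && (j != rev_ord i))
        (tcoef i / tcoef j)
          *: (delta_mx (rev_ord i) j *t delta_mx i (rev_ord j))).

End QuantumGroup.

(* Main.v *)
(** The coproduct rule makes the two components of the commutator of [e_i] with
    an element [y] of [U^-] adjoint, for the pairing, to left and right
    multiplication by [e_i]. Expanding in dual bases gives the intertwining relation
    (e_i (x) 1 + w_i (x) e_i) Theta = Theta (e_i (x) 1 + w'_i (x) e_i).

    Write the action of Theta on V (x) V as the sum of the E_ab (x) L_ab.
    As Theta fixes the vectors v_2n (x) v, and as every other v_p is, up to a scalar,
    e_i v_q for some i and q > p, the relation determines the blocks L_ap from the
    L_aq, by descending induction on the second index. The closed form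
      L_aa = 1,  L_b'b = z_b E_bb',  L_ab = x_ab E_ba + y_ab E_a'b' (a > b)
    satisfies this recursion, and multiplying by f~ and tau turns its entries into
    those of R^. *)
Require Import Defs.
From HB Require Import structures.
From mathcomp Require Import all_boot all_order all_algebra.
From mathcomp.classical Require Import boolp classical_sets functions fsbigop.
From mathcomp Require Import reals.
From mathcomp.real_closed Require Import complex mxtens.
From mathcomp Require Import zify ring.

Set Implicit Arguments.
Unset Strict Implicit.
Unset Printing Implicit Defensive.

Import Order.TTheory GRing.Theory Num.Theory.
Local Open Scope ring_scope.

(** Neither a basis of U^+ or U^- nor any Theta_mu is computed: the dual bases stay abstract, and
    only the expansion of an element in them is used. What is concrete about U^- is its
    triangularity on V: an element of degree -mu moves a basis vector down by at least the height of
    mu. This bounds the support of the sum defining Theta and makes Theta the identity on v_2n (x)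
    v.

    The middle of the basis is the obstacle. The weights of v_n and v_n' differ by 2 eps_n, which is
    not a root, so the induction cannot go from v_n' to v_n. It reaches v_n from v_(n-1)' through
    e_n and steps over v_n'.

    The constants x, y, z are those of R^ with the scalars of f~ divided out, so the recursion only
    has to be checked. Along a raising edge, the ratio of consecutive t_i is what the recursion of y
    dictates. In z, the summand 1 of 1 - r^(n-i) s^(i-n) comes from an x and the other summand from
    a y. *)

Section LinearFunction.
Context (K : fieldType) (V W : lmodType K) (g : V -> W).
Hypothesis lin_g : linear g.

(** Bilinear maps come with a bare proof of linearity in each variable. Packing a partial map into a
    structure gives access to the general lemmas on linear maps. *)
Let gl : {linear V -> W} := HB.pack g (GRing.isLinear.Build K V W _ g lin_g).

Lemma fun_linearB u v : g (u - v) = g u - g v.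
Proof. exact: (linearB gl). Qed.

Lemma fun_linear_sum (I : Type) (r : seq I) (b : I -> K) (v : I -> V) :
  g (\sum_(i <- r) b i *: v i) = \sum_(i <- r) b i *: g (v i).
Proof.
transitivity (\sum_(i <- r) g (b i *: v i)); first exact: (linear_sum gl).
by apply: eq_bigr => i _; exact: (linearZ_LR gl).
Qed.

Lemma fun_linear_sum1 (I : Type) (r : seq I) (v : I -> V) :
  g (\sum_(i <- r) v i) = \sum_(i <- r) g (v i).
Proof. exact: (linear_sum gl). Qed.

End LinearFunction.

(** * Degrees of words in the generators *)

Lemma content_cons n (i : 'I_n) l : content (i :: l) = delta_mx 0 i + content l.
Proof. by rewrite /content big_cons. Qed.

Lemma content_ge0 n (l : seq 'I_n) i : 0 <= content l 0 i.
Proof.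
elim: l => [|j l IHl]; first by rewrite /content big_nil mxE.
by rewrite content_cons !mxE addr_ge0 // ler0n.
Qed.

Lemma content_eq0 n (l : seq 'I_n) : content l = 0 -> l = [::].
Proof.
case: l => // i l /rowP /(_ i) /eqP; rewrite content_cons !mxE !eqxx.
by rewrite gt_eqF // ltr_wpDr // content_ge0.
Qed.

(** * Skew derivations and dual bases *)

Section SkewPairing.
Local Open Scope classical_set_scope.
Context (K : fieldType) (n : nat) (A : algType K).
Context (e f w wV w' w'V : 'I_n -> A) (q k : 'I_n -> 'I_n -> K) (a c : K).
Context (Delta : {lrmorphism A -> tensor A A}) (B : A -> A -> K).

(** Copies of [Ule], [Uge], [Uminus] and [Uplus] over an abstract algebra, known only through the
    hypotheses below. In the application [q i j] is (w'_i, w_j), [k i j] is the scalar that moves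
    w'_i to the right of f_j, [a] is 1/(r-s) and [c] is 1/(s-r). *)
Let Ale : set A := subalg (range f `|` range w' `|` range w'V).
Let Age : set A := subalg (range e `|` range w `|` range wV).
Let Aminus mu : set A := lspan [set \prod_(i <- l) f i | l in [set l | content l = mu]].
Let Aplus mu : set A := lspan [set \prod_(i <- l) e i | l in [set l | content l = mu]].

Hypothesis ef : forall i j,
  e i * f j - f j * e i = if i == j then a *: (w i - w' i) else 0.
Hypothesis fwC : forall i j, f j * w i = q j i *: (w i * f j).
Hypothesis w'fC : forall i j, w' i * f j = k i j *: (f j * w' i).
Hypothesis Delta_w : forall i, Delta (w i) = tens (w i) (w i).
Hypothesis Delta_w' : forall i, Delta (w' i) = tens (w' i) (w' i).
Hypothesis Delta_e : forall i, Delta (e i) = tens (e i) 1 + tens (w i) (e i).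
Hypothesis Delta_f : forall i, Delta (f i) = tens 1 (f i) + tens (f i) (w' i).
Hypothesis B_linl : forall b y y' x, Ale y -> Ale y' -> Age x ->
  B (b *: y + y') x = b * B y x + B y' x.
Hypothesis B_linr : forall b y x x', Ale y -> Age x -> Age x' ->
  B y (b *: x + x') = b * B y x + B y x'.
Hypothesis B_mull : forall y y' x (l : seq (A * A)), Ale y -> Ale y' -> Age x ->
  (forall p, p \in l -> Age p.1 /\ Age p.2) ->
  Delta x = \sum_(p <- l) tens p.1 p.2 ->
  B (y * y') x = \sum_(p <- l) B y p.1 * B y' p.2.
Hypothesis B_mulr : forall y x x' (l : seq (A * A)), Ale y -> Age x -> Age x' ->
  (forall p, p \in l -> Ale p.1 /\ Ale p.2) ->
  Delta y = \sum_(p <- l) tens p.1 p.2 ->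
  B y (x * x') = \sum_(p <- l) B p.1 x' * B p.2 x.
Hypothesis B_fw : forall i j, B (f i) (w j) = 0.
Hypothesis B_w'e : forall i j, B (w' i) (e j) = 0.
Hypothesis B_fe : forall i j, B (f i) (e j) = (i == j)%:R * c.
Hypothesis B_11 : B 1 1 = 1.
Hypothesis B_1w : forall i, B 1 (w i) = 1.
Hypothesis B_w'1 : forall i, B (w' i) 1 = 1.
Hypothesis B_w'w : forall i j, B (w' i) (w j) = q i j.

Local Notation fw l := (\prod_(i <- l) f i).
Local Notation ew l := (\prod_(i <- l) e i).

Let Ale1 : Ale 1. Proof. exact: subalg1. Qed.
Let Age1 : Age 1. Proof. exact: subalg1. Qed.
Let AleM y y' : Ale y -> Ale y' -> Ale (y * y'). Proof. exact: subalgM. Qed.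
Let AgeM x x' : Age x -> Age x' -> Age (x * x'). Proof. exact: subalgM. Qed.
Let AleP b y y' : Ale y -> Ale y' -> Ale (b *: y + y'). Proof. exact: subalgP. Qed.
Let AgeP b x x' : Age x -> Age x' -> Age (b *: x + x'). Proof. exact: subalgP. Qed.
Let Ale0 : Ale 0.
Proof. by have := AleP (-1) Ale1 Ale1; rewrite scaleN1r addNr. Qed.
Let Age0 : Age 0.
Proof. by have := AgeP (-1) Age1 Age1; rewrite scaleN1r addNr. Qed.
Let Ale_f i : Ale (f i). Proof. by apply: subalg_sub; left; left; exists i. Qed.
Let Ale_w' i : Ale (w' i). Proof. by apply: subalg_sub; left; right; exists i. Qed.
Let Age_e i : Age (e i). Proof. by apply: subalg_sub; left; left; exists i. Qed.
Let Age_w i : Age (w i). Proof. by apply: subalg_sub; left; right; exists i. Qed.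
Hint Resolve Ale1 Age1 Ale0 Age0 Ale_f Ale_w' Age_e Age_w : core.

Let Aplus_Age mu x : Aplus mu x -> Age x.
Proof.
elim=> {x} [x [l _ <-]||b x y _ hx _ hy] //; last exact: AgeP.
by elim: l => [|i l IHl]; rewrite ?big_nil // big_cons; apply: AgeM.
Qed.

Let Aminus_Ale mu y : Aminus mu y -> Ale y.
Proof.
elim=> {y} [y [l _ <-]||b x y _ hx _ hy] //; last exact: AleP.
by elim: l => [|i l IHl]; rewrite ?big_nil // big_cons; apply: AleM.
Qed.

Let B_0l x : Age x -> B 0 x = 0.
Proof.
move=> hx; have := B_linl (-1) Ale0 Ale0 hx.
by rewrite scaler0 addr0 mulN1r addNr.
Qed.

Let B_0r y : Ale y -> B y 0 = 0.
Proof.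
move=> hy; have := B_linr (-1) hy Age0 Age0.
by rewrite scaler0 addr0 mulN1r addNr.
Qed.

Let B_Zl b y x : Ale y -> Age x -> B (b *: y) x = b * B y x.
Proof.
by move=> hy hx; rewrite -[b *: y]addr0 B_linl // B_0l // addr0.
Qed.

Let B_suml (I : eqType) (l : seq I) (b : I -> K) (h : I -> A) x :
  {in l, forall p, Ale (h p)} -> Age x ->
  B (\sum_(p <- l) b p *: h p) x = \sum_(p <- l) b p * B (h p) x.
Proof.
move=> hl hx.
suff [] : Ale (\sum_(p <- l) b p *: h p) /\
   B (\sum_(p <- l) b p *: h p) x = \sum_(p <- l) b p * B (h p) x by [].
elim: l hl => [|p l IHl] hl; first by rewrite !big_nil B_0l.
have [|h1 h2] := IHl; first by move=> q' ql; apply: hl; rewrite inE ql orbT.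
have hp := hl p (mem_head _ _).
by rewrite !big_cons B_linl // h2; split=> //; apply: AleP.
Qed.

Let B_sumr (I : eqType) (l : seq I) (b : I -> K) (h : I -> A) y :
  {in l, forall p, Age (h p)} -> Ale y ->
  B y (\sum_(p <- l) b p *: h p) = \sum_(p <- l) b p * B y (h p).
Proof.
move=> hl hy.
suff [] : Age (\sum_(p <- l) b p *: h p) /\
   B y (\sum_(p <- l) b p *: h p) = \sum_(p <- l) b p * B y (h p) by [].
elim: l hl => [|p l IHl] hl; first by rewrite !big_nil B_0r.
have [|h1 h2] := IHl; first by move=> q' ql; apply: hl; rewrite inE ql orbT.
have hp := hl p (mem_head _ _).
by rewrite !big_cons B_linr // h2; split=> //; apply: AgeP.
Qed.

Let B_M_w y y' i : Ale y -> Ale y' -> B (y * y') (w i) = B y (w i) * B y' (w i).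
Proof.
move=> hy hy'; rewrite (B_mull (l := [:: (w i, w i)])) ?big_seq1 //.
by move=> p; rewrite inE => /eqP ->; split=> /=.
Qed.

(** Pairing f_j with 1 * 1 gives (f_j, 1) = 2 (f_j, 1). The same device, applied to (1 * 1, e_i),
    gives [B_1e]. *)
Let B_f1 j : B (f j) 1 = 0.
Proof.
have := B_mulr (l := [:: (1, f j); (f j, w' j)]) (Ale_f j) Age1 Age1.
rewrite !big_cons !big_nil !addr0 /= Delta_f B_11 B_w'1 !mulr1 mul1r.
move=> /(_ _ erefl) H; apply: (addrI (B (f j) 1)); rewrite addr0 -H //.
by move=> p; rewrite !inE => /orP[] /eqP ->; split=> /=.
Qed.

Let B_M_e y y' i : Ale y -> Ale y' ->
  B (y * y') (e i) = B y (e i) * B y' 1 + B y (w i) * B y' (e i).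
Proof.
move=> hy hy'; rewrite (B_mull (l := [:: (e i, 1); (w i, e i)])) //.
- by rewrite !big_cons big_nil addr0.
- by move=> p; rewrite !inE => /orP[] /eqP ->; split=> /=.
- by rewrite Delta_e !big_cons big_nil addr0.
Qed.

Let B_1e i : B 1 (e i) = 0.
Proof.
have := B_M_e i Ale1 Ale1; rewrite mul1r B_11 B_1w mul1r mulr1.
by move=> H; apply: (addrI (B 1 (e i))); rewrite addr0 -H.
Qed.

Let Aminus_mulf mu nu i y : Aminus mu y -> mu + delta_mx 0 i = nu ->
  Aminus nu (y * f i).
Proof.
move=> hy <-; elim: hy => {y} [y [l lmu <-]||b y y' _ hy _ hy'].
- apply: lspan_sub; exists (rcons l i); last by rewrite -cats1 big_cat big_seq1.
  by rewrite /= /content -cats1 big_cat big_seq1 -lmu.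
- by rewrite mul0r; exact: lspan0.
- by rewrite mulrDl -scalerAl; apply: lspanP.
Qed.

Let Aplus_mule mu nu i x : Aplus mu x -> mu + delta_mx 0 i = nu ->
  Aplus nu (x * e i) /\ Aplus nu (e i * x).
Proof.
move=> hx <-; elim: hx => {x} [x [l lmu <-]||b x x' _ [hl hr] _ [hl' hr']].
- have cl : mu + delta_mx 0 i = content (rcons l i).
    by rewrite /content -cats1 big_cat big_seq1 -lmu.
  split; apply: lspan_sub; [exists (rcons l i)|exists (i :: l)]; rewrite //=.
  + by rewrite -cats1 big_cat big_seq1.
  + by rewrite content_cons lmu addrC.
  + by rewrite big_cons.
- by rewrite mul0r mulr0; split; exact: lspan0.
- by rewrite mulrDl mulrDr -scalerAl -scalerAr; split; apply: lspanP.
Qed.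

Let AminusZ mu b y : Aminus mu y -> Aminus mu (b *: y).
Proof. by move=> hy; rewrite -[_ *: _]addr0; apply: lspanP => //; exact: lspan0. Qed.

Let AminusD mu y y' : Aminus mu y -> Aminus mu y' ->
  Aminus mu (y + y').
Proof. by move=> hy hy'; rewrite -[y]scale1r; apply: lspanP. Qed.

(* Of the coproduct of a word, only the contractions of one of its legs with [w i]
   and [e i] matter; on them, appending a letter acts by a simple recursion. *)
Lemma fword_skew i (l : seq 'I_n) :
  exists (P : seq (A * A)) (chi : K) (y' y'' : A),
  [/\ [/\ {in P, forall p, Ale p.1 /\ Ale p.2},
      Delta (fw l) = \sum_(p <- P) tens p.1 p.2,
      \sum_(p <- P) B p.1 (w i) *: p.2 = fw l,
      \sum_(p <- P) B p.2 (w i) *: p.1 = chi *: fw l &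
      fw l * w i = chi *: (w i * fw l)],
    \sum_(p <- P) B p.1 (e i) *: p.2 = c *: (y'' * w' i),
    \sum_(p <- P) B p.2 (e i) *: p.1 = c *: y',
    e i * fw l - fw l * e i = a *: (w i * y' - y'' * w' i) &
    Aminus (content l - delta_mx 0 i) y' /\ Aminus (content l - delta_mx 0 i) y''].
Proof.
elim/last_ind: l => [|l j [P [chi [y' [y'' [[PU DP chi1 chi2 wl] lam1 lam2 comm [y'U
    y''U]]]]]]].
  exists [:: (1, 1)], 1, 0, 0; rewrite !big_nil !big_seq1 /= rmorph1 B_1w B_1e.
  rewrite !scale1r !scale0r mul0r mulr0 !mul1r !mulr1 !scaler0 !subrr scaler0.
  split=> //; first by split=> // p; rewrite inE => /eqP ->; split=> /=.
  by split; exact: lspan0.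
have fwr : fw (rcons l j) = fw l * f j by rewrite -cats1 big_cat big_seq1.
have flU : Ale (fw l).
  by apply: (@Aminus_Ale (content l)); apply: lspan_sub; exists l.
(* The old presentation multiplied on the right by 1 (x) f_j, then by f_j (x) w'_j. *)
set P' := [seq (p.1, p.2 * f j) | p <- P] ++ [seq (p.1 * f j, p.2 * w' j) | p <- P].
(* The new derivatives come from [e_i, y f_j] = [e_i, y] f_j + y [e_i, f_j]: taking w_i out of the
   word to the left costs [chi], and moving w'_i right past f_j costs [k i j]. *)
exists P', (chi * q j i), (y' * f j + ((j == i)%:R * chi) *: fw l),
  (k i j *: (y'' * f j) + (j == i)%:R *: fw l).
rewrite !big_cat !big_map /= fwr.
split; [split|..].
- move=> p; rewrite mem_cat => /orP[] /mapP [p0 /PU [h1 h2] ->] /=; split=> //; exact: AleM.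
- have -> : Delta (fw l * f j) = Delta (fw l) * Delta (f j) by exact: rmorphM.
  rewrite DP Delta_f mulrDr !mulr_suml; congr (_ + _); apply: eq_bigr => p _.
    by rewrite tensM mulr1.
  by rewrite tensM.
- rewrite [X in _ + X]big1_seq => [|p /andP[_ /PU [h1 h2]]].
    by rewrite addr0 -chi1 mulr_suml; apply: eq_bigr => p _; rewrite scalerAl.
  by rewrite B_M_w // B_fw mulr0 scale0r.
- rewrite [X in X + _]big1_seq => [|p /andP[_ /PU [h1 h2]]].
    rewrite add0r mulrC -scalerA scalerAl -chi2 mulr_suml scaler_sumr.
    apply: eq_big_seq => p /PU [h1 h2].
    by rewrite B_M_w // B_w'w -scalerAl scalerA mulrC.
  by rewrite B_M_w // B_fw mulr0 scale0r.
- by rewrite -mulrA fwC -scalerAr [fw l * (w i * _)]mulrA wl -scalerAl scalerA mulrA [chi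
    * _]mulrC.
- transitivity (c *: (y'' * w' i) * f j + ((j == i)%:R * c) *: (fw l * w' j)).
    congr (_ + _).
      by rewrite -lam1 mulr_suml; apply: eq_bigr => p _; rewrite -scalerAl.
    rewrite -chi1 mulr_suml scaler_sumr; apply: eq_big_seq => p /PU [h1 h2].
    by rewrite B_M_e // B_f1 mulr0 add0r B_fe -scalerAl scalerA mulrC.
  rewrite -scalerAl -mulrA w'fC -scalerAr mulrA mulrC -scalerA -scalerDr mulrDl -!scalerAl.
  congr (_ *: (_ + _)).
  by case: eqVneq => [->|]; rewrite // !scale0r.
- transitivity (((j == i)%:R * c) *: (chi *: fw l) + c *: y' * f j).
    congr (_ + _).
      rewrite -chi2 scaler_sumr; apply: eq_big_seq => p /PU [h1 h2].
      by rewrite B_M_e // B_f1 mulr0 add0r B_fe scalerA mulrC.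
    rewrite -lam2 mulr_suml; apply: eq_big_seq => p /PU [h1 h2].
    rewrite B_M_e // B_w'1 mulr1 B_w'e mulr0 addr0.
    by rewrite -scalerAl.
  by rewrite addrC -scalerAl [_ * c]mulrC -(scalerA c) -scalerDr scalerA.
- transitivity ((e i * fw l - fw l * e i) * f j + fw l * (e i * f j - f j * e i)).
    by rewrite mulrBl mulrBr !mulrA subrKA.
  rewrite comm ef eq_sym mulrDr mulrDl -!scalerAl mulrBl -mulrA -[y'' * _ * _]mulrA.
  rewrite w'fC -scalerAr mulrA.
  case: eqVneq => [->|_].
    by rewrite mul1r !scale1r -!scalerAr mulrBr wl -scalerDr [y'' * (_ * _)]mulrA opprD
        addrACA.
  by rewrite mul0r !scale0r mulr0 !addr0 mulr0 addr0 [y'' * (_ * _)]mulrA.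
- have cE : content l - delta_mx 0 i + delta_mx 0 j = content (rcons l j) - delta_mx 0 i.
    by rewrite addrAC /content -cats1 big_cat big_seq1.
  have Ul b : Aminus (content (rcons l j) - delta_mx 0 i) (((j == i)%:R * b) *: fw l).
    case: eqVneq => [->|_]; last by rewrite mul0r scale0r; exact: lspan0.
    apply: AminusZ; apply: lspan_sub; exists l => //=.
    by rewrite /content -cats1 big_cat big_seq1 addrK.
  split; apply: AminusD => //; first exact: Aminus_mulf cE.
    by apply: AminusZ; exact: Aminus_mulf cE.
  by have := Ul 1; rewrite mulr1.
Qed.

(** In the coproduct of a word in the e_j, every term but (word) (x) 1 has a letter e_j in its
    second leg, and w'_i pairs with such a leg to 0. *)
Lemma eword_counit i (l : seq 'I_n) :
  exists P : seq (A * A),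
  [/\ {in P, forall p, Age p.1 /\ Age p.2},
      Delta (ew l) = \sum_(p <- P) tens p.1 p.2 &
      \sum_(p <- P) B (w' i) p.2 *: p.1 = ew l].
Proof.
elim/last_ind: l => [|l j [P [PA DP cP]]].
  exists [:: (1, 1)]; rewrite !big_nil !big_seq1 /= rmorph1 B_w'1 scale1r.
  by split=> // p; rewrite inE => /eqP ->; split=> /=.
have ewr : ew (rcons l j) = ew l * e j by rewrite -cats1 big_cat big_seq1.
exists ([seq (p.1 * e j, p.2) | p <- P] ++ [seq (p.1 * w j, p.2 * e j) | p <- P]).
rewrite !big_cat !big_map /= ewr; split.
- move=> p; rewrite mem_cat => /orP[] /mapP [p0 /PA [h1 h2] ->] /=; split=> //; exact: AgeM.
- have -> : Delta (ew l * e j) = Delta (ew l) * Delta (e j) by exact: rmorphM.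
  rewrite DP Delta_e mulrDr !mulr_suml; congr (_ + _); apply: eq_bigr => p _.
    by rewrite tensM mulr1.
  by rewrite tensM.
- rewrite [X in _ + X]big1_seq ?addr0 => [|p /andP[_ /PA [h1 h2]]].
    by rewrite -cP mulr_suml; apply: eq_bigr => p _; rewrite scalerAl.
  rewrite (B_mulr (l := [:: (w' i, w' i)])) ?big_seq1 ?B_w'e ?mul0r ?scale0r //.
  by move=> p0; rewrite inE => /eqP ->; split=> /=.
Qed.

(** Contracting the second leg of the coproduct of [x] with w'_i returns [x]. This removes the
    factor w'_i that accompanies the second skew derivative. *)
Lemma B_mulw'_Aplus i mu y x : Ale y -> Aplus mu x -> B (y * w' i) x = B y x.
Proof.
move=> hy; elim=> {x} [x [l _ <-]||b x x' hx IHx hx' IHx']; last 2 first.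
- by rewrite !B_0r //; exact: AleM.
- have [xA x'A] := (@Aplus_Age mu x hx, @Aplus_Age mu x' hx').
  by rewrite !B_linr ?IHx ?IHx' //; exact: AleM.
have [P [PA DP cP]] := eword_counit i l.
have el : Age (ew l).
  by apply: (@Aplus_Age (content l)); apply: lspan_sub; exists l.
rewrite (B_mull hy (Ale_w' i) el PA DP) -[in RHS]cP.
rewrite B_sumr //; last by move=> p /PA [].
by apply: eq_bigr => p _; rewrite mulrC.
Qed.

(* [y'] and [y''] are the two skew derivatives of [y] along [f i]. *)
Lemma Aminus_skew i mu y : Aminus mu y ->
  exists y' y'', [/\ Aminus (mu - delta_mx 0 i) y', Aminus (mu - delta_mx 0 i) y'',
    e i * y - y * e i = a *: (w i * y' - y'' * w' i) &
    forall nu x, Aplus nu x ->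
      B y (e i * x) = c * B y' x /\ B y (x * e i) = c * B y'' x].
Proof.
elim=> {y} [y [l lmu <-]||b y1 y2 hy1 [u1 [v1 [u1U v1U comm1 adj1]]] hy2 [u2 [v2 [u2U v2U
    comm2 adj2]]]].
- have [P [chi [y' [y'' [[PU DP chi1 chi2 wl] lam1 lam2 comm [y'U y''U]]]]]] :=
    fword_skew i l.
  exists y', y''; rewrite -lmu; split=> // nu x hx.
  have xU := Aplus_Age hx; have flU : Ale (fw l).
    by apply: (@Aminus_Ale (content l)); apply: lspan_sub; exists l.
  have y'A := Aminus_Ale y'U; have y''A := Aminus_Ale y''U.
  (* The pairing reverses products in its second argument: left multiplication by e_i contracts the
     second leg of the coproduct, which yields [y'], and right multiplication contracts the first,
     which yields [y'' * w' i]. *)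
  rewrite !(B_mulr flU _ _ PU DP) //; split.
    rewrite -B_Zl // -lam2 B_suml //; last by move=> p /PU [].
    by apply: eq_bigr => p _; rewrite mulrC.
  by rewrite -(B_mulw'_Aplus i y''A hx) -B_Zl ?lam1 -?lam1 ?B_suml //;
     [move=> p /PU [] | exact: AleM].
- exists 0, 0; split; try exact: lspan0.
    by rewrite !(mulr0, mul0r) subrr scaler0.
  by move=> nu x /Aplus_Age hx; rewrite !B_0l ?mulr0 //; apply: AgeM.
- exists (b *: u1 + u2), (b *: v1 + v2); split; try exact: lspanP.
    transitivity (b *: (e i * y1 - y1 * e i) + (e i * y2 - y2 * e i)).
      by rewrite mulrDr mulrDl -scalerAr -scalerAl scalerBr opprD addrACA.
    rewrite comm1 comm2 scalerA mulrC -scalerA -scalerDr; congr (_ *: _).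
    by rewrite scalerBr mulrDr mulrDl -scalerAr -scalerAl opprD addrACA.
  move=> nu x hx; have xU := Aplus_Age hx.
  have [h1 h2] := adj1 _ _ hx; have [h3 h4] := adj2 _ _ hx.
  have [y1A y2A] := (@Aminus_Ale mu _ hy1, @Aminus_Ale mu _ hy2).
  have [u1A u2A] := (Aminus_Ale u1U, Aminus_Ale u2U).
  have [v1A v2A] := (Aminus_Ale v1U, Aminus_Ale v2U).
  rewrite !B_linl ?h1 ?h2 ?h3 ?h4 //; try exact: AgeM.
  by rewrite !mulrDr ![c * (b * _)]mulrCA.
Qed.

(** The expansions are what the intertwining relation consumes. They also hold for the family 1 in
    degree 0 and for the empty family when some coordinate is negative, degrees for which
    [are_dual_bases] provides nothing. *)
Definition dual_families mu (d : nat) (x y : 'I_d -> A) : Prop :=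
  [/\ forall j, Aplus mu (x j), forall j, Aminus mu (y j),
      forall v, Aminus mu v -> v = \sum_j B v (x j) *: y j &
      forall u, Aplus mu u -> u = \sum_j B (y j) u *: x j].

Lemma basis_dual_families mu d (x y : 'I_d -> A) :
  is_basis (Aplus mu) x -> is_basis (Aminus mu) y ->
  (forall i j, B (y i) (x j) = (i == j)%:R) -> dual_families mu x y.
Proof.
move=> [xU xb] [yU yb] Bxy.
have yA j := Aminus_Ale (yU j); have xA j := Aplus_Age (xU j).
split=> // [v /yb [b [-> _]]|u /xb [b [-> _]]]; apply: eq_bigr => j _; congr (_ *: _).
  rewrite B_suml // (bigD1 j) //= Bxy eqxx mulr1 big1 ?addr0 // => i ij.
  by rewrite Bxy (negbTE ij) mulr0.
rewrite B_sumr // (bigD1 j) //= Bxy eqxx mulr1 big1 ?addr0 // => i ij.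
by rewrite Bxy eq_sym (negbTE ij) mulr0.
Qed.

Lemma dual_families0 : dual_families 0 (fun=> 1 : A) (fun _ : 'I_1 => 1 : A).
Proof.
split=> [j|j|v vU|u uU].
- by apply: lspan_sub; exists [::]; rewrite ?big_nil //= /content big_nil.
- by apply: lspan_sub; exists [::]; rewrite ?big_nil //= /content big_nil.
- rewrite big_ord1; have [b ->] : exists b, v = b *: 1.
    elim: vU => {v} [v [l /content_eq0 -> <-]||b v v' _ [b1 ->] _ [b2 ->]].
    + by exists 1; rewrite big_nil scale1r.
    + by exists 0; rewrite scale0r.
    + by exists (b * b1 + b2); rewrite scalerDl scalerA.
  by rewrite B_Zl // B_11 mulr1.
- rewrite big_ord1; have [b ->] : exists b, u = b *: 1.
    elim: uU => {u} [v [l /content_eq0 -> <-]||b v v' _ [b1 ->] _ [b2 ->]].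
    + by exists 1; rewrite big_nil scale1r.
    + by exists 0; rewrite scale0r.
    + by exists (b * b1 + b2); rewrite scalerDl scalerA.
  by rewrite -[b *: 1]addr0 B_linr // B_0r // B_11 !addr0 mulr1.
Qed.

Lemma dual_families_neg (mu : 'rV[int]_n) i : mu 0 i < 0 ->
  dual_families mu (fun=> 0 : A) (fun _ : 'I_0 => 0 : A).
Proof.
move=> mui; split=> [[]|[]|v vU|u uU] //; rewrite big_ord0.
  elim: vU => {v} [v [l lmu _]|//|b v v' _ -> _ ->]; last by rewrite scaler0 addr0.
  by have := content_ge0 l i; rewrite lmu leNgt mui.
elim: uU => {u} [v [l lmu _]|//|b v v' _ -> _ ->]; last by rewrite scaler0 addr0.
by have := content_ge0 l i; rewrite lmu leNgt mui.
Qed.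

(** The degree mu part of the intertwining relation, seen through a bilinear map. The commutators
    [e_i, y_j] are expanded in the family of degree mu - alpha_i. By adjunction their coefficients
    are the pairings of y_j with e_i x'_m and x'_m e_i, and summing over j rebuilds these products
    from the x_j. The sign in a = -c puts each term on its side. *)
Lemma quasiR_intertwine mu i d d' (x y : 'I_d -> A) (x' y' : 'I_d' -> A)
    (M : lmodType K) (g : A -> A -> M) :
  c != 0 -> a = - c -> is_bilinear g ->
  dual_families mu x y -> dual_families (mu - delta_mx 0 i) x' y' ->
  \sum_j g (e i * y j) (x j) + \sum_j g (w i * y' j) (e i * x' j) =
  \sum_j g (y j * e i) (x j) + \sum_j g (y' j * w' i) (x' j * e i).
Proof.
move=> c0 ac [gl gr] [xU yU yE xE] [x'U y'U y'E x'E].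
have comm j : e i * y j - y j * e i =
    \sum_m B (y j) (x' m * e i) *: (y' m * w' i) -
    \sum_m B (y j) (e i * x' m) *: (w i * y' m).
  have [u [v [uU vU -> adj]]] := Aminus_skew i (yU j).
  rewrite {1}(y'E _ uU) {1}(y'E _ vU) ac mulr_sumr mulr_suml scaleNr -scalerN opprB.
  rewrite scalerBr !scaler_sumr; congr (_ - _); apply: eq_bigr => m _.
    by have [_ ->] := adj _ _ (x'U m); rewrite -scalerAl scalerA.
  by have [-> _] := adj _ _ (x'U m); rewrite -scalerAr scalerA.
(* After exchanging the sums, the coefficients B(y_j, h_m) of the x_j are those of the expansion of
   h_m. *)
have sumE (h : 'I_d' -> A) (hU : forall m, Aplus mu (h m)) (z : 'I_d' -> A) :
    \sum_j g (\sum_m B (y j) (h m) *: z m) (x j) = \sum_m g (z m) (h m).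
  under eq_bigr => j _ do rewrite (fun_linear_sum (gl _)).
  rewrite exchange_big; apply: eq_bigr => m _ /=.
  by rewrite [in RHS](xE _ (hU m)) (fun_linear_sum (gr _)).
have AplusM m : Aplus mu (x' m * e i) /\ Aplus mu (e i * x' m).
  by apply: (Aplus_mule (x'U m)); rewrite subrK.
have commE : \sum_j g (e i * y j) (x j) - \sum_j g (y j * e i) (x j) =
    \sum_m g (y' m * w' i) (x' m * e i) - \sum_m g (w i * y' m) (e i * x' m).
  rewrite -sumrB; under eq_bigr => j _ do
    rewrite -(fun_linearB (gl _)) comm (fun_linearB (gl _)).
  by rewrite sumrB !sumE // => m; case: (AplusM m).
apply/eqP; rewrite -subr_eq0 opprD addrACA commE.
by rewrite addrA subrK subrr.
Qed.

End SkewPairing.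

(** * The intertwining relation of Theta *)

Section RootLattice.
Context (K : fieldType) (rh sh : K) (n : nat).

Lemma root_of_delta (i : 'I_n) : root_of (delta_mx 0 i) = alpha i.
Proof.
rewrite /root_of (bigD1 i) //= mxE !eqxx scale1r big1 ?addr0 // => j ji.
by rewrite mxE (negbTE ji) scale0r.
Qed.

Lemma root_of0 : root_of (0 : 'rV_n) = 0.
Proof. by rewrite /root_of big1 // => j _; rewrite mxE scale0r. Qed.

Lemma wpair0l (m : 'rV_n) : wpair rh sh 0 m = 1.
Proof.
rewrite /wpair /rpow /spow /form2 !big1 ?expr0z ?invr1 ?mulr1 // => i _;
  by rewrite big1 // => j _; rewrite mxE ?(mulr0, mul0r).
Qed.

Lemma wpair0r (m : 'rV_n) : wpair rh sh m 0 = 1.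
Proof.
rewrite /wpair /rpow /spow /form2 !big1 ?expr0z ?invr1 ?mulr1 // => i _;
  by rewrite big1 // => j _; rewrite mxE ?(mulr0, mul0r).
Qed.

End RootLattice.

(** * The relations and the pairing of the quantum group *)

Section UrsPairing.
Local Open Scope quotient_scope.
Local Open Scope classical_set_scope.
Context (K : fieldType) (rh sh : K) (n : nat).
Local Notation U := (Urs rh sh n).
Local Notation e := (@ugen K rh sh n KE).
Local Notation f := (@ugen K rh sh n KF).
Local Notation w := (@ugen K rh sh n KW).
Local Notation w' := (@ugen K rh sh n KW').
Local Notation r := (rh ^+ 2).
Local Notation s := (sh ^+ 2).
Local Notation F := (freealg K (gen n)).

Let pi (x : F) : U := \pi_(quoalg (@urs_rel K rh sh n)) x.
Let piD x y : pi (x + y) = pi x + pi y. Proof. exact/esym/pi_quo_add. Qed.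
Let piN x : pi (- x) = - pi x. Proof. exact/esym/pi_quo_opp. Qed.
Let piM x y : pi (x * y) = pi x * pi y. Proof. exact/esym/pi_quo_mul. Qed.
Let piZ c x : pi (c *: x) = c *: pi x. Proof. exact/esym/pi_quo_scale. Qed.
Let pi0 : pi 0 = 0. Proof. by []. Qed.
Let pi_rel x : urs_rel rh sh x -> pi x = 0.
Proof. by move=> h; apply/quo_eqP; rewrite subr0; apply: ideal_of_sub. Qed.

Lemma urs_ef i j : e i * f j - f j * e i =
  if i == j then (r - s)^-1 *: (w i - w' i) else 0 :> U.
Proof.
have := pi_rel (rel_ef rh sh i j).
by case: (i == j); rewrite !(piD, piN, piM, piZ, pi0) => /eqP; rewrite subr_eq0 => /eqP.
Qed.

Lemma urs_wf i j : w i * f j =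
  (rpow rh (alpha j) (alpha i))^-1 * spow sh (alpha i) (alpha j) *: (f j * w i) :> U.
Proof.
have := pi_rel (rel_wf rh sh i j).
by rewrite !(piD, piN, piM, piZ, pi0) => /eqP; rewrite subr_eq0 => /eqP.
Qed.

Lemma urs_w'f i j : w' i * f j =
  rpow rh (alpha i) (alpha j) * (spow sh (alpha j) (alpha i))^-1 *: (f j * w' i) :> U.
Proof.
have := pi_rel (rel_w'f rh sh i j).
by rewrite !(piD, piN, piM, piZ, pi0) => /eqP; rewrite subr_eq0 => /eqP.
Qed.

Hypotheses (rh0 : rh != 0) (sh0 : sh != 0).

Lemma urs_fw i j : f j * w i = wpair rh sh (alpha j) (alpha i) *: (w i * f j) :> U.
Proof.
rewrite urs_wf scalerA /wpair.
have r0 : rpow rh (alpha j) (alpha i) != 0 by exact: expfz_neq0.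
have s0 : spow sh (alpha i) (alpha j) != 0 by exact: expfz_neq0.
by rewrite [_^-1 * spow _ _ _]mulrC mulrA mulfVK // divff // scale1r.
Qed.

Let prod_zpow_delta (x xV : 'I_n -> U) i :
  \prod_(j < n) zpow (x j) (xV j) ((delta_mx 0 i : 'rV[int]_n) 0 j) = x i.
Proof.
transitivity (\prod_(j < n) (if j == i then x j else 1)).
  apply: eq_bigr => j _; rewrite mxE eqxx /=.
  by case: (j == i) => //=; rewrite ?expr1.
rewrite -big_mkcond /=.
exact: (@big_pred1_eq _ _ _ _ i x).
Qed.

Let omegaQ0 : @omegaQ K rh sh n 0 = 1.
Proof. by apply: big1 => i _; rewrite mxE. Qed.
Let omega'Q0 : @omega'Q K rh sh n 0 = 1.
Proof. by apply: big1 => i _; rewrite mxE. Qed.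
Let omegaQ_delta i : @omegaQ K rh sh n (delta_mx 0 i) = w i.
Proof. exact: prod_zpow_delta. Qed.
Let omega'Q_delta i : @omega'Q K rh sh n (delta_mx 0 i) = w' i.
Proof. exact: prod_zpow_delta. Qed.

Variables (Delta : {lrmorphism U -> tensor U U}) (B : U -> U -> K).
Hypotheses (hD : is_coproduct Delta) (hB : is_pairing Delta B).

(** The toral values of the pairing are given on omega'_lambda and omega_mu only. Taking lambda and
    mu to be 0 or simple roots recovers 1, w'_i and w_j. *)
Let B_11 : B 1 1 = 1.
Proof. by have := pairing_w'w hB 0 0; rewrite omegaQ0 omega'Q0 root_of0 wpair0l. Qed.
Let B_1w i : B 1 (w i) = 1.
Proof.
by have := pairing_w'w hB 0 (delta_mx 0 i); rewrite omegaQ_delta omega'Q0 root_of0 wpair0l.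
Qed.
Let B_w'1 i : B (w' i) 1 = 1.
Proof.
by have := pairing_w'w hB (delta_mx 0 i) 0; rewrite omega'Q_delta omegaQ0 root_of0 wpair0r.
Qed.
Let B_w'w i j : B (w' i) (w j) = wpair rh sh (alpha i) (alpha j).
Proof.
have := pairing_w'w hB (delta_mx 0 i) (delta_mx 0 j).
by rewrite omega'Q_delta omegaQ_delta !root_of_delta.
Qed.
Let B_fe i j : B (f i) (e j) = (i == j)%:R * (s - r)^-1.
Proof. exact: pairing_fe hB i j. Qed.

Hypothesis rs : r != s.
Variables (d : 'rV[int]_n -> nat) (x y : forall mu, 'I_(d mu) -> U).
Arguments x : clear implicits.
Arguments y : clear implicits.
Hypothesis xy : are_dual_bases B x y.

Lemma Uplus_dual_families mu : Qpos mu -> dual_families e f B mu (x mu) (y mu).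
Proof.
move=> /xy [xb yb Bxy].
exact: (basis_dual_families (pairing_linl hB) (pairing_linr hB) xb yb).
Qed.

(* Extended by [Theta_0 = 1], and by [0] off the positive cone, so that the recursion
   in [mu] and [mu - alpha_i] holds for every [mu]. *)
Definition Theta_degree (M : lmodType K) (g : U -> U -> M) (mu : 'rV[int]_n) : M :=
  if mu == 0 then g 1 1
  else if [forall i, 0 <= mu 0 i] then \sum_j g (y mu j) (x mu j) else 0.

(** Whatever the sign of its coordinates, each degree carries dual families, so the intertwining
    relation can be stated for mu and mu - alpha_i without a case distinction. *)
Lemma Theta_degree_dual (M : lmodType K) (g : U -> U -> M) mu :
  is_bilinear g ->
  exists d' (x' y' : 'I_d' -> U), dual_families e f B mu x' y' /\
    Theta_degree g mu = \sum_j g (y' j) (x' j).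
Proof.
move=> bg; rewrite /Theta_degree; have [->|mu0] := eqVneq mu 0.
  exists 1%N, (fun=> 1), (fun=> 1); rewrite big_ord1; split=> //.
  exact: (dual_families0 (pairing_linl hB) (pairing_linr hB) B_11).
have [/forallP mu_ge0|] := boolP [forall i, 0 <= mu 0 i].
  exists (d mu), (x mu), (y mu); split=> //.
  exact: Uplus_dual_families.
move=> /forallPn [j]; rewrite -ltNge => muj; exists 0%N, (fun=> 0), (fun=> 0).
split; last by rewrite big_ord0.
exact: dual_families_neg muj.
Qed.

Lemma Theta_degree_intertwine m (g : U -> U -> 'M[K]_m) mu i :
  is_bilinear g -> (forall u u' v v', g (u * u') (v * v') = g u v *m g u' v') ->
  g (e i) 1 *m Theta_degree g mu +
    g (w i) (e i) *m Theta_degree g (mu - delta_mx 0 i) =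
  Theta_degree g mu *m g (e i) 1 +
    Theta_degree g (mu - delta_mx 0 i) *m g (w' i) (e i).
Proof.
move=> bg gM.
have [d1 [x1 [y1 [xy1 ->]]]] := Theta_degree_dual mu bg.
have [d2 [x2 [y2 [xy2 ->]]]] := Theta_degree_dual (mu - delta_mx 0 i) bg.
have c0 : (s - r)^-1 != 0 by rewrite invr_neq0 // subr_eq0 eq_sym.
have ac : (r - s)^-1 = - (s - r)^-1 by rewrite -[r - s]opprB invrN.
have := quasiR_intertwine urs_ef urs_fw urs_w'f (coproduct_w hD) (coproduct_w' hD)
  (coproduct_e hD) (coproduct_f hD) (pairing_linl hB) (pairing_linr hB)
  (pairing_mull hB) (pairing_mulr hB) (pairing_fw hB) (pairing_w'e hB) B_fe
  B_11 B_1w B_w'1 B_w'w c0 ac bg xy1 xy2.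
rewrite !mulmx_sumr !mulmx_suml => H; move: H.
congr (_ + _ = _ + _); apply: eq_bigr => j _; rewrite -gM ?mul1r ?mulr1 //.
Qed.

End UrsPairing.

Lemma subr_bij (V : zmodType) (v : V) : bijective (fun u => u - v).
Proof. by exists (fun u => u + v) => u; rewrite ?subrK ?addrK. Qed.

(** * The action of Theta on the tensor square of V *)

Section ThetaOperator.
Local Open Scope quotient_scope.
Local Open Scope classical_set_scope.
Context (K : fieldType) (rh sh : K) (n : nat).
Local Notation U := (Urs rh sh n).
Local Notation e := (@ugen K rh sh n KE).
Local Notation f := (@ugen K rh sh n KF).
Local Notation w := (@ugen K rh sh n KW).
Local Notation w' := (@ugen K rh sh n KW').
Local Notation N := (2 * n)%N.
Hypothesis n_gt0 : (0 < n)%N.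
Variable rho : {lrmorphism U -> 'M[K]_N}.
Hypothesis hrho : is_fundamental rho.

Local Notation g := (fun u v : U => rho u *t rho v).

Let rhoM u v : rho (u * v) = rho u *m rho v. Proof. exact: rmorphM. Qed.
Let rho1 : rho 1 = 1%:M. Proof. exact: rmorph1. Qed.

Lemma rho_tens_bilinear : is_bilinear g.
Proof.
split=> [b c x y|a c x y] /=; rewrite linearP.
  by apply/matrixP => i j; rewrite !mxE mulrDl mulrA.
by apply/matrixP => i j; rewrite !mxE mulrDr mulrCA.
Qed.

Lemma rho_f_lower i (a b : 'I_N) : (a <= b)%N -> rho (f i) a b = 0.
Proof.
move=> ab; rewrite (fundamental_f hrho).
have E0 p q : (q < p)%N -> ((a == p :> nat) && (b == q :> nat))%:R = 0 :> K.
  move=> qp; case: eqP => // ap; case: eqP => // bq.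
  by move: ab; rewrite ap bq leqNgt qp.
case: i => i i_lt /=; have := i_lt; rewrite /pr => i_lt'.
by case: ifP => i1; rewrite !mxE !E0 ?(mulr0, subrr) //; lia.
Qed.

Definition height (mu : 'rV[int]_n) : int := \sum_i mu 0 i.

Lemma height_content (l : seq 'I_n) : height (content l) = (size l)%:Z.
Proof.
elim: l => [|i l IHl].
  by rewrite /height /content big_nil big1 // => i _; rewrite mxE.
have -> : height (content (i :: l)) = height (delta_mx 0 i) + height (content l).
  by rewrite content_cons -big_split; apply: eq_bigr => j _; rewrite mxE.
rewrite IHl /height (bigD1 i) //= big1 ?addr0 => [|j ji]; last by rewrite mxE (negbTE ji)
    andbF.
by rewrite mxE !eqxx -[RHS]/((1 + size l)%N%:Z) PoszD.
Qed.

(** Each letter f_i is strictly lower triangular, and all words of degree mu have length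
    [height mu]. *)
Lemma rho_Uminus_lower mu (y : U) (a b : 'I_N) : @Uminus K rh sh n mu y ->
  a%:Z < b%:Z + height mu -> rho y a b = 0.
Proof.
move=> yU; elim: yU a b => {y} [y [l <- <-]||c y y' _ IHy _ IHy'] a b h; last 2 first.
- by rewrite linear0 mxE.
- by rewrite linearP !mxE IHy // IHy' // mulr0 addr0.
move: h; rewrite height_content; elim: l a => [|i l IHl] a.
  rewrite big_nil rho1 mxE addr0 => ab.
  by case: eqP => // eab; move: ab; rewrite eab ltxx.
move=> h; rewrite big_cons rhoM mxE big1 // => k _.
have [ak|ka] := leqP a k; first by rewrite rho_f_lower ?mul0r.
rewrite IHl ?mulr0 //; move: h ka => /=; lia.
Qed.

Variables (Delta : {lrmorphism U -> tensor U U}) (B : U -> U -> K).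
Hypotheses (rh0 : rh != 0) (sh0 : sh != 0) (rs : rh ^+ 2 != sh ^+ 2).
Hypotheses (hD : is_coproduct Delta) (hB : is_pairing Delta B).
Variables (d : 'rV[int]_n -> nat) (x y : forall mu, 'I_(d mu) -> U).
Arguments x : clear implicits.
Arguments y : clear implicits.
Hypothesis xy : are_dual_bases B x y.

Local Notation Theta := (@Theta_degree K rh sh n d x y _ g).

(** A coordinate of at least 2n makes the height at least 2n, and lowering an index by that much
    leaves the range of V. *)
Lemma Theta_degree_support (mu : 'rV[int]_n) : Theta mu != 0 -> forall i, (0 <= mu 0 i <
    N%:Z).
Proof.
rewrite /Theta_degree; have [->|mu0] := eqVneq mu 0.
  by move=> _ i; rewrite mxE lexx /=; lia.
case: ifP => [/forallP mu_ge0 + i|]; last by rewrite eqxx.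
apply: contraNT; rewrite mu_ge0 -leNgt => mui; apply/eqP; apply: big1 => j _.
have muQ : Qpos mu by [].
have [_ [yU _] _] := xy muQ.
suff -> : rho (y mu j) = 0 by rewrite tens0mx.
apply/matrixP => a b; rewrite (rho_Uminus_lower (yU j)) ?mxE //.
apply: lt_le_trans (_ : N%:Z <= _); first by have := ltn_ord a; lia.
apply: le_trans (_ : height mu <= _); last by rewrite lerDr.
apply: le_trans mui _; rewrite /height (bigD1 i) //= lerDl.
by apply: sumr_ge0 => k _.
Qed.

(* The bound exceeds that of [Theta_degree_support] by one, which leaves room for a
   shift by a simple root. *)
Definition box : seq 'rV[int]_n :=
  [seq \row_i (phi i : nat)%:Z | phi : {ffun 'I_n -> 'I_N.+1}].

Lemma box_uniq : uniq box.
Proof.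
rewrite map_inj_uniq ?enum_uniq // => phi psi /rowP h.
by apply/ffunP => i; apply/val_inj; have := h i; rewrite !mxE => -[].
Qed.

Lemma mem_box (mu : 'rV[int]_n) : (forall i, 0 <= mu 0 i <= N%:Z) -> mu \in box.
Proof.
move=> h; apply/mapP; exists [ffun i => inord (absz (mu 0 i))]; rewrite ?mem_enum //.
apply/rowP => i; rewrite !mxE ffunE inordK; move: (mu _ i) (h i) => z zb; lia.
Qed.

(** The box is convenient for algebra with finite sums, the full lattice for reindexing by a
    translation, under which the box is not stable. *)
Lemma sum_box (M : nmodType) (h : 'rV[int]_n -> M) :
  (forall mu, h mu != 0 -> mu \in box) ->
  \sum_(mu <- box) h mu = \sum_(mu \in [set: 'rV[int]_n]) h mu.
Proof.
move=> hbox; rewrite (@bigfs _ _ _ _ _ predT _ box_uniq); last first.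
  by move=> mu _ /negP mub; apply/eqP/negPn/negP => /hbox.
by apply: eq_fsbigl; apply/seteqP; split.
Qed.

(** A sum over an infinite set has the value 0 by convention when its support is infinite. The bound
    on the support makes the sum in [Theta_act] a genuine one, and the degree 0 term accounts for
    the identity. *)
Lemma Theta_act_box : Theta_act rho x y = \sum_(mu <- box) Theta mu.
Proof.
have box0 : 0 \in box by apply: mem_box => i; rewrite mxE.
rewrite (bigD1_seq _ box0 box_uniq) /= {1}/Theta_degree eqxx rho1 /Theta_act.
congr (_ + _).
  by apply/matrixP => i j; case: (mxtens_indexP i) => a c; case: (mxtens_indexP j) => b p;
    rewrite tensmxE !mxE (can_eq (@mxtens_indexK _ _)) xpair_eqE -natrM mulnb.
pose P (mu : 'rV[int]_n) := (mu != 0) && [forall i, 0 <= mu 0 i].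
have thetaE mu : P mu -> act2 rho (Theta_part x y mu) = Theta mu.
  rewrite /P /Theta_degree => /andP[/negPf -> ->].
  rewrite /Theta_part /act2 (fun_linear_sum1 (tensor_lift_linear rho_tens_bilinear)).
  by apply: eq_bigr => j _; rewrite (tensor_lift_tens _ _ rho_tens_bilinear).
transitivity (\sum_(mu \in [set` P]) act2 rho (Theta_part x y mu)).
  apply: eq_fsbigl; apply/seteqP; split => mu /=.
    by move=> [mu0 mu_ge0]; apply/andP; split => //; apply/forallP.
  by move=> /andP[mu0 /forallP].
rewrite -(@bigfs _ _ _ _ box P) ?box_uniq //; last first.
  move=> mu Pmu; apply: contraNeq; rewrite thetaE // => /Theta_degree_support h.
  by apply: mem_box => i; have := h i; lia.
rewrite (eq_bigr _ thetaE) [RHS]big_mkcond [LHS]big_mkcond /=; apply: eq_bigr => mu _.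
rewrite /P; case: eqVneq => //= mu0; case: ifP => // mu_ge0.
by rewrite /Theta_degree (negPf mu0) mu_ge0.
Qed.

Lemma Theta_act_intertwine i :
  (rho (e i) *t 1%:M + rho (w i) *t rho (e i)) *m Theta_act rho x y =
  Theta_act rho x y *m (rho (e i) *t 1%:M + rho (w' i) *t rho (e i)).
Proof.
(* In the degree mu relation, the terms in w_i (x) e_i and w'_i (x) e_i carry Theta of degree mu -
   alpha_i. Summed over all mu, these shifted components also give Theta. *)
have shift : \sum_(mu <- box) Theta (mu - delta_mx 0 i) = \sum_(mu <- box) Theta mu.
  rewrite !sum_box => [|mu /Theta_degree_support h|mu /Theta_degree_support h].
  - rewrite [RHS](reindex_fsbigT (fun mu => mu - delta_mx 0 i)) //.
    exact: subr_bij.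
  - by apply: mem_box => j; have := h j; lia.
  - apply: mem_box => j; have := h j; rewrite !mxE eqxx /=; case: (j == i); lia.
rewrite Theta_act_box mulmxDl mulmxDr -{2 4}shift !mulmx_sumr !mulmx_suml -!big_split /=.
apply: eq_bigr => mu _; rewrite -rho1.
apply: (Theta_degree_intertwine rh0 sh0 hD hB rs xy (g := g) mu i rho_tens_bilinear).
move=> u u' v v'; transitivity ((rho u *m rho u') *t (rho v *m rho v')).
  by congr (_ *t _); exact: rhoM.
by rewrite tensmx_mul.
Qed.

(** The index [b] is that of v_2n, which every element of U^- of degree -mu with mu > 0 kills, since
    the height of mu is positive. *)
Lemma Theta_act_lowest a c (b p : 'I_N) : b.+1 = N ->
  Theta_act rho x y (mxtens_index (a, c)) (mxtens_index (b, p)) =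
  ((a == b) && (c == p))%:R.
Proof.
have box0 : 0 \in box by apply: mem_box => i; rewrite mxE.
move=> bN; rewrite Theta_act_box (bigD1_seq _ box0 box_uniq) /= mxE summxE.
rewrite {1}/Theta_degree eqxx rho1 tensmxE !mxE -natrM mulnb big1 ?addr0 // => mu mu0.
rewrite /Theta_degree (negPf mu0); case: ifP => [/forallP mu_ge0|]; last by rewrite mxE.
rewrite summxE big1 // => j _; rewrite tensmxE.
have muQ : Qpos mu by [].
have [_ [yU _] _] := xy muQ.
rewrite (rho_Uminus_lower (yU j)) ?mul0r //.
have mu_pos : 0 < height mu.
  rewrite lt0r sumr_ge0 // andbT; apply: contraNneq mu0 => h0.
  apply/eqP/rowP => i; rewrite mxE; apply/eqP; move/eqP: h0.
  by rewrite psumr_eq0 // => /allP /(_ i); apply; rewrite mem_index_enum.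
by have := ltn_ord a; lia.
Qed.

End ThetaOperator.

(** * The blocks of Theta *)

Section TensorBlocks.
Context (K : fieldType) (m : nat).
Implicit Types (A C : 'M[K]_m) (T : 'M[K]_(m * m)).

(** The matrix [T] is the sum of the E_ab (x) [blk T a b]. *)
Definition blk T (a b : 'I_m) : 'M[K]_m :=
  \matrix_(c, p) T (mxtens_index (a, c)) (mxtens_index (b, p)).

Lemma sum_mxtens_index (F : 'I_(m * m) -> K) :
  \sum_k F k = \sum_a \sum_c F (mxtens_index (a, c)).
Proof.
rewrite pair_bigA (reindex (@mxtens_index m m)) /=; last first.
  by exists (@mxtens_unindex m m) => k _; rewrite ?mxtens_indexK ?mxtens_unindexK.
by apply: eq_bigr => -[a c].
Qed.

Lemma blkD T1 T2 a b : blk (T1 + T2) a b = blk T1 a b + blk T2 a b.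
Proof. by apply/matrixP => c p; rewrite !mxE. Qed.

Lemma blk_tensmul A C T a b :
  blk (A *t C *m T) a b = \sum_a' A a a' *: (C *m blk T a' b).
Proof.
apply/matrixP => c p; rewrite !mxE summxE sum_mxtens_index.
apply: eq_bigr => a' _; rewrite !mxE mulr_sumr; apply: eq_bigr => c' _.
by rewrite tensmxE mxE mulrA.
Qed.

Lemma blk_multens A C T a b :
  blk (T *m (A *t C)) a b = \sum_b' A b' b *: (blk T a b' *m C).
Proof.
apply/matrixP => c p; rewrite !mxE summxE sum_mxtens_index.
apply: eq_bigr => b' _; rewrite !mxE mulr_sumr; apply: eq_bigr => p' _.
by rewrite tensmxE mxE mulrCA.
Qed.

Lemma blk_intertwine E W W' T a b :
  (E *t 1%:M + W *t E) *m T = T *m (E *t 1%:M + W' *t E) ->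
  \sum_a' E a a' *: blk T a' b + \sum_a' W a a' *: (E *m blk T a' b) =
  \sum_b' E b' b *: blk T a b' + \sum_b' W' b' b *: (blk T a b' *m E).
Proof.
move/(congr1 (fun M => blk M a b)).
rewrite mulmxDl mulmxDr !blkD !blk_tensmul !blk_multens.
under eq_bigr => a' _ do rewrite mul1mx.
by move=> ->; congr (_ + _); apply: eq_bigr => b1 _; rewrite mulmx1.
Qed.

End TensorBlocks.

(** * The closed form of the blocks and its recursion *)

Section LOperators.
Context (K : fieldType) (n : nat).
Local Notation N := (2 * n)%N.
Variables (x y : 'I_N -> 'I_N -> K) (z : 'I_N -> K).

(** The test a = b' precedes the test b < a. For b in the second half, b' < b and this block lies
    above the diagonal, so [z] has to vanish there. *)
Definition Lop (a b : 'I_N) : 'M[K]_N :=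
  if a == b then 1%:M
  else if a == rev_ord b then z b *: delta_mx b (rev_ord b)
  else if (b < a)%N then x a b *: delta_mx b a + y a b *: delta_mx (rev_ord a) (rev_ord b)
  else 0.

Variables (p q : 'I_N) (al be : K) (wa : 'I_N -> K) (wq : K).
Local Notation p' := (rev_ord p).
Local Notation q' := (rev_ord q).
Hypotheses (pq : (p < q)%N) (qp' : q != p').
Hypothesis p_next_q : forall a : 'I_N, (p < a < q)%N -> a = p'.
Hypothesis x_next : forall a : 'I_N, (q < a)%N -> a != p' -> a != q' -> x a p = wa a * x
    a q.
Hypothesis y_next : forall a : 'I_N, (q < a)%N -> a != p' -> a != q' ->
  al * y a p = - (wq * be * y a q).
Hypotheses (x_qp : al * x q p = (wa q - wq) * al) (y_qp : al * y q p = (wa q - wq) * be).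
Hypothesis z_p : al * z p = if (q < p')%N then wa p' * (al * x p' q) - wq * (be * y p' q)
    else 0.
Hypothesis x_q'p : (q < p')%N -> al * x q' p = be * y p' q + wa q' * (al * z q).
Hypothesis y_q'p : (q < p')%N -> al * y q' p = be * x p' q - wq * (be * z q).
Hypothesis z_q : (p' < q)%N -> z q = 0.

Local Notation E := (al *: delta_mx p q + be *: delta_mx q' p').

(** The (a, q) block of the intertwining relation, solved for the block (a, p). Here [E] is the
    raising operator, [wa a] the eigenvalue of w_i on v_a and [wq] that of w'_i on v_q. The
    hypotheses on [x], [y] and [z] compare coefficients of matrix units: [x_next] and [y_next] for
    generic a > q, the others for a among q, p', q'. *)
Lemma Lop_step a : al *: Lop a p =
  ((a == p)%:R * al) *: Lop q q + ((a == q')%:R * be) *: Lop p' q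
  + wa a *: (E *m Lop a q) - wq *: (Lop a q *m E).
Proof.
have oE (u v : 'I_N) : (u == v) = (u == v :> nat) by [].
have rE (u : 'I_N) : rev_ord u = (N - u.+1)%N :> nat by [].
have pN := ltn_ord p; have qN := ltn_ord q; have aN := ltn_ord a.
have qp'n : (q != N - p.+1 :> nat)%N by rewrite -rE -oE.
have EM c b : E *m delta_mx c b = (al * (q == c)%:R) *: delta_mx p b + (be * (p' ==
    c)%:R) *: delta_mx q' b.
  by rewrite mulmxDl -!scalemxAl !mul_delta_mx_cond -!scaler_nat !scalerA.
have ME c b : delta_mx c b *m E = (al * (b == p)%:R) *: delta_mx c q + (be * (b ==
    q')%:R) *: delta_mx c p'.
  by rewrite mulmxDr -!scalemxAr !mul_delta_mx_cond -!scaler_nat !scalerA.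
have EMZ u c b : E *m (u *: delta_mx c b) = u *: (E *m delta_mx c b) by rewrite scalemxAr.
have MEZ u c b : (u *: delta_mx c b) *m E = u *: (delta_mx c b *m E) by rewrite scalemxAl.
have EMD (A C : 'M[K]_N) : E *m (A + C) = E *m A + E *m C by rewrite mulmxDr.
have MED (A C : 'M[K]_N) : (A + C) *m E = A *m E + C *m E by rewrite mulmxDl.
have simp := (mulr0, mulr1, scale0r, scaler0, addr0, add0r).
have [->|ap] := eqVneq a p.
  have pq' : (p == q') = false by clear -pN qN aN pq qp'n oE rE; rewrite oE rE; lia.
  have pnq : (p == q) = false by clear -pq oE; rewrite oE; lia.
  have qp : (q < p)%N = false by lia.
  rewrite /Lop !eqxx pnq pq' qp.
  by rewrite mulmx0 mul0mx !scaler0 mul0r scale0r mul1r !addr0 subr0.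
have [->|aq] := eqVneq a q.
  have qp : (q == p) = false by clear -pq oE; rewrite oE; lia.
  have qq' : (q == q') = false by clear -pN qN aN pq qp'n oE rE; rewrite oE rE; lia.
  rewrite /Lop !eqxx qp qq' (negPf qp') pq !mul0r !scale0r !add0r mulmx1 mul1mx.
  by rewrite -scalerBl !scalerDr !scalerA x_qp y_qp.
have [->|ap'] := eqVneq a p'.
  have E1 : (p' == p) = false by clear -pN qN aN pq qp'n oE rE; rewrite oE rE; lia.
  have E2 : (p' == q') = false by clear -pN qN aN pq qp'n oE rE; rewrite oE !rE; lia.
  have E3 : (p' == q) = false by rewrite eq_sym (negPf qp').
  have E4 : (p == q) = false by clear -pq oE; rewrite oE; lia.
  rewrite /Lop !eqxx E1 E2 E3 !mul0r !scale0r !add0r scalerA z_p.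
  case: ifP => qp'lt; last by rewrite mulmx0 mul0mx !scaler0 scale0r subr0.
  have E5 : (q' == p) = false by clear -pN qN aN pq qp'n oE rE; rewrite oE rE; lia.
  rewrite rev_ordK EMD MED !EMZ !MEZ !EM !ME !eqxx E1 E2 E3 E5 [q == p]eq_sym E4 !simp.
  by rewrite !scalerA -scalerBl; congr (_ *: _); ring.
have [->|aq'] := eqVneq a q'.
  have E1 : (q' == p) = false by clear -pN qN aN pq qp'n oE rE; rewrite oE rE; lia.
  have E2 : (q' == p') = false by clear -pN qN aN pq qp'n oE rE; rewrite oE !rE; lia.
  have E3 : (q' == q) = false by clear -pN qN aN pq qp'n oE rE; rewrite oE rE; lia.
  have E4 : (p' == q') = false by clear -pN qN aN pq qp'n oE rE; rewrite oE !rE; lia.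
  have E5 : (p' == q) = false by rewrite eq_sym (negPf qp').
  have E6 : (q == p) = false by clear -pq oE; rewrite oE; lia.
  rewrite /Lop !eqxx E1 E2 E3 E4 E5 mul0r scale0r add0r mul1r.
  have [qp'lt|] := boolP (q < p')%N.
    have -> : (p < q')%N by move: qp'lt; clear -rE pN qN; rewrite !rE; lia.
    rewrite EMZ MEZ EM ME !eqxx E5 E1 !simp rev_ordK !scalerDr !scalerA.
    rewrite rev_ordK -!mulrA [z q * al]mulrC [z q * be]mulrC x_q'p // y_q'p // scalerDl
        scalerBl.
    by rewrite addrA [X in X - _ = _]addrC addrA.
  (* On and beyond the middle edge, where p' < q, all terms vanish: q' < p puts the block (q', p)
     above the diagonal, and [z q] is 0. *)
  rewrite -leqNgt => p'q; have p'ltq : (p' < q)%N.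
    by move: qp' p'q; clear -oE; rewrite oE; lia.
  have -> : (p < q')%N = false by move: p'ltq; clear -rE pN qN; rewrite !rE; lia.
  by rewrite z_q // !simp mulmx0 mul0mx !scaler0 subr0.
have E1 : (q == rev_ord a) = false.
  by apply/eqP => qa; move: aq'; rewrite qa rev_ordK eqxx.
have E2 : (p' == rev_ord a) = false by rewrite (inj_eq rev_ord_inj) eq_sym (negPf ap).
rewrite /Lop (negPf ap) (negPf aq) (negPf ap') (negPf aq') !mul0r !scale0r !add0r.
have [qa|aq2] := ltnP q a.
  have E3 : (q' == p) = false.
    by apply/eqP => q'p; move: qp'; rewrite -q'p rev_ordK eqxx.
  rewrite (ltn_trans pq qa) EMD MED !EMZ !MEZ !EM !ME !eqxx E1 E2 E3.
  rewrite (negPf ap) (negPf aq') [p' == q]eq_sym (negPf qp') !simp.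
  rewrite !scalerDr !scalerA y_next // x_next //.
  by rewrite scaleNr; congr (_ *: _ - _ *: _); ring.
(* An index strictly between p and q can only be p', already treated, so the blocks (a, p) and (a,
   q) are both above the diagonal. *)
have -> : (p < a)%N = false.
  apply/negP => pa; move/eqP: ap'; apply; apply: p_next_q.
  by rewrite pa /= ltn_neqAle aq2 andbT -oE.
by rewrite mulmx0 mul0mx !scaler0 subr0.
Qed.

End LOperators.

Section DeltaSums.
Context (K : fieldType) (m : nat) (V : lmodType K) (X : 'I_m -> V).
Implicit Types (u v : K) (a p q : 'I_m).

Lemma sum_pred1 (P : pred 'I_m) a (F : 'I_m -> V) :
  \sum_(i | P i) (a == i)%:R *: F i = (P a)%:R *: F a.
Proof.
rewrite big_mkcond (bigD1 a) //= eqxx big1 ?addr0 => [|i ia].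
  by case: (P a); rewrite ?scale1r ?scale0r.
by rewrite eq_sym (negPf ia) scale0r if_same.
Qed.

Lemma sum_row_delta2 u v p q p' q' a :
  \sum_b (u *: delta_mx p q + v *: delta_mx p' q') a b *: X b =
  ((a == p)%:R * u) *: X q + ((a == p')%:R * v) *: X q'.
Proof.
rewrite -[X q]scale1r -[X q']scale1r -[1 *: X q](sum_pred1 predT) -[1 *: X q'](sum_pred1
    predT).
rewrite !scaler_sumr -big_split; apply: eq_bigr => b _ /=.
rewrite !scalerA -scalerDl !mxE -!mulnb !natrM ![_ == b]eq_sym; congr (_ *: _); ring.
Qed.

Lemma sum_col_delta2 u v p q p' q' b :
  \sum_a (u *: delta_mx p q + v *: delta_mx p' q') a b *: X a =
  ((b == q)%:R * u) *: X p + ((b == q')%:R * v) *: X p'.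
Proof.
rewrite -[X p]scale1r -[X p']scale1r -[1 *: X p](sum_pred1 predT) -[1 *: X p'](sum_pred1
    predT).
rewrite !scaler_sumr -big_split; apply: eq_bigr => a _ /=.
rewrite !scalerA -scalerDl !mxE -!mulnb !natrM ![_ == a]eq_sym; congr (_ *: _); ring.
Qed.

End DeltaSums.

(** * The weights of V and their pairings *)

Section Weights.
Context (K : fieldType) (rh sh : K) (n : nat).
Hypotheses (rh0 : rh != 0) (sh0 : sh != 0).
Local Notation N := (2 * n)%N.
Local Notation wp := (@wpair K rh sh n).
Implicit Types (l m : 'rV[int]_n) (a b : 'I_N).

Lemma form2Nl l m : form2 (- l) m = - form2 l m.
Proof.
rewrite /form2 -sumrN; apply: eq_bigr => i _; rewrite -sumrN; apply: eq_bigr => j _.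
by rewrite mxE mulrN mulNr.
Qed.

Lemma form2Nr l m : form2 l (- m) = - form2 l m.
Proof.
rewrite /form2 -sumrN; apply: eq_bigr => i _; rewrite -sumrN; apply: eq_bigr => j _.
by rewrite mxE mulrN.
Qed.

Lemma form2Dl l m m' : form2 (l + m) m' = form2 l m' + form2 m m'.
Proof.
rewrite /form2 -big_split; apply: eq_bigr => i _; rewrite -big_split; apply: eq_bigr => j _.
by rewrite mxE mulrDr mulrDl.
Qed.

Lemma form2Dr l m m' : form2 l (m + m') = form2 l m + form2 l m'.
Proof.
rewrite /form2 -big_split; apply: eq_bigr => i _; rewrite -big_split; apply: eq_bigr => j _.
by rewrite mxE mulrDr.
Qed.

Lemma form2_delta (i j : 'I_n) :
  form2 (delta_mx 0 i) (delta_mx 0 j) = if (i < j)%N then -1 else 1.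
Proof.
rewrite /form2 (bigD1 i) //= (bigD1 j) //= !mxE !eqxx !mulr1.
rewrite !big1 ?addr0 // => k ki; first by rewrite big1 // => k' _; rewrite !mxE (negPf
    ki) andbF mulr0 mul0r.
by rewrite !mxE (negPf ki) andbF mulr0.
Qed.

Lemma wpair_neq0 l m : wp l m != 0.
Proof. by rewrite /wpair mulf_neq0 ?invr_neq0 //; exact: expfz_neq0. Qed.

Lemma wpairNl l m : wp (- l) m = (wp l m)^-1.
Proof. by rewrite /wpair /rpow /spow form2Nl form2Nr -!invr_expz invfM. Qed.

Lemma wpairNr l m : wp l (- m) = (wp l m)^-1.
Proof. by rewrite /wpair /rpow /spow form2Nl form2Nr -!invr_expz invfM. Qed.

Lemma wpairDl l m m' : wp (l + m) m' = wp l m' * wp m m'.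
Proof. by rewrite /wpair /rpow /spow form2Dl form2Dr !expfzDr // invfM mulrACA. Qed.

Lemma wpairDr l m m' : wp l (m + m') = wp l m * wp l m'.
Proof. by rewrite /wpair /rpow /spow form2Dl form2Dr !expfzDr // invfM mulrACA. Qed.

Lemma epsV_small (i : 'I_n) a : a = i :> nat -> epsV a = delta_mx 0 i :> 'rV_n.
Proof.
move=> ai; apply/rowP => j; rewrite !mxE eqxx /= ai /pr.
have -> : (j == N - i.+1 :> nat)%N = false by have := ltn_ord j; have := ltn_ord i; lia.
by rewrite subr0.
Qed.

Lemma epsV_rev a : epsV (rev_ord a) = - epsV a :> 'rV_n.
Proof.
apply/rowP => j; rewrite !mxE /pr /= opprB.
by have -> : (N - (N - a.+1).+1 = a)%N by have := ltn_ord a; lia.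
Qed.

(** The scalar (omega'_lambda, omega_mu) for the weights lambda of v_a and mu of v_b. Passing from
    an index to its dual inverts it, which reduces all values to the first half. *)
Definition wV a b : K := wp (epsV a) (epsV b).

Lemma wV_revl a b : wV (rev_ord a) b = (wV a b)^-1.
Proof. by rewrite /wV epsV_rev wpairNl. Qed.

Lemma wV_revr a b : wV a (rev_ord b) = (wV a b)^-1.
Proof. by rewrite /wV epsV_rev wpairNr. Qed.

Lemma wV_neq0 a b : wV a b != 0. Proof. exact: wpair_neq0. Qed.

Lemma wV_small a b : (a < n)%N -> (b < n)%N ->
  wV a b = if (a < b)%N then (rh * sh)^-1 else if (b < a)%N then rh * sh else rh / sh.
Proof.
move=> an bn; rewrite /wV (epsV_small (i := Ordinal an)) // (epsV_small (i := Ordinal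
    bn)) //.
rewrite /wpair /rpow /spow !form2_delta /=.
case: ltngtP => _; rewrite ?expr1z ?exprN1 ?invrK ?invfM //.
Qed.

Lemma wV_diag a : wV a a = rh / sh.
Proof.
have [an|na] := ltnP a n; first by rewrite wV_small // ltnn.
rewrite -(rev_ordK a) wV_revl wV_revr invrK wV_small ?ltnn //=; have := ltn_ord a; lia.
Qed.

End Weights.

(** * The recursion along the raising operators *)

Section ThetaLOperators.
Context (K : fieldType) (rh sh : K) (n : nat).
Hypotheses (rh0 : rh != 0) (sh0 : sh != 0).
Local Notation N := (2 * n)%N.
Local Notation U := (Urs rh sh n).
Local Notation e := (@ugen K rh sh n KE).
Local Notation w := (@ugen K rh sh n KW).
Local Notation w' := (@ugen K rh sh n KW').
Local Notation r := (rh ^+ 2).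
Local Notation s := (sh ^+ 2).
Local Notation wV := (@wV K rh sh n).
Local Notation t := (@tcoef K rh sh n).

(** The coefficients of R^ with f~ undone. The entry of R^ in column (u, v) is an entry of Theta
    divided by [wV u v]. This divisor is [wV a b] for [Theta_x] and (r/s)^(-1/2) for the other two,
    which turns the prefactor (rs)^(-1/2) into 1/r. *)
Definition Theta_x (a b : 'I_N) : K := (s - r) / (rh * sh) * wV a b.
Definition Theta_y (a b : 'I_N) : K := (r - s) / r * (t (rev_ord a) / t (rev_ord b)).
Definition Theta_z (b : 'I_N) : K :=
  if (b < n)%N then (s - r) / r * (1 - r ^+ (n - b.+1) * s ^- (n - b.+1)) else 0.

Local Notation L := (Lop Theta_x Theta_y Theta_z).

Lemma tcoef_small (i : 'I_N) : (i < n)%N -> t i = s ^- (n - i.+1).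
Proof.
move=> i_n; rewrite /tcoef i_n; have -> : i.+1%:Z - n%:Z = - (n - i.+1)%N%:Z by lia.
by rewrite -invr_expz.
Qed.

Lemma tcoef_large (i : 'I_N) : (n <= i)%N -> t i = r ^- (i - n).
Proof.
move=> n_i; rewrite /tcoef ltnNge n_i /=; have -> : n%:Z - i%:Z = - (i - n)%N%:Z by lia.
by rewrite -invr_expz.
Qed.

Lemma tcoef_rev_small (i : 'I_N) : (i < n)%N -> t (rev_ord i) = r ^- (n - i.+1).
Proof.
by move=> i_n; rewrite tcoef_large /=; [congr (_ ^- _)|]; have := ltn_ord i; lia.
Qed.

Lemma tcoef_neq0 i : t i != 0.
Proof. by rewrite /tcoef; case: ifP => _; rewrite expfz_neq0 // expf_neq0. Qed.

Section Edge.
Variables (p q : 'I_N) (al be : K) (alpha_pq : 'rV[int]_n).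
Hypothesis alphaE : alpha_pq = epsV p - epsV q.
Hypotheses (pq : (p < q)%N) (qp' : q != rev_ord p).
Hypothesis p_next_q : forall a : 'I_N, (p < a < q)%N -> a = rev_ord p.
Hypothesis t_next : al * t (rev_ord q) * wV p q = - (rh / sh * be * t (rev_ord p)).
Hypothesis Wqp : wV q p * wV p q = 1.
Hypothesis Wsr : (s - r) / (rh * sh) * wV q p = wV q p / (rh / sh) - rh / sh / wV p q.

(** One computation for all raising edges. [t_next] is the recursion of the t_i along the edge, and
    [Wsr] matches the subdiagonal coefficient with the difference of the eigenvalues of w_i and w'_i
    on v_q. It holds for both values (rs)^(1/2) and (rs)^(-1/2) of [wV q p]. The premises [small]
    and [large] separate the edges inside the first half from the rest. *)
Lemma Lop_edge a :
  ((q < rev_ord p)%N -> [/\ al = 1, be = -1, p.+1 = q & (q < n)%N]) ->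
  ((rev_ord p < q)%N -> Theta_z p = 0 /\ Theta_z q = 0) ->
  al *: L a p =
  ((a == p)%:R * al) *: L q q + ((a == rev_ord q)%:R * be) *: L (rev_ord p) q
  + wpair rh sh (epsV a) alpha_pq *:
      ((al *: delta_mx p q + be *: delta_mx (rev_ord q) (rev_ord p)) *m L a q)
  - (wpair rh sh alpha_pq (epsV q))^-1 *:
      (L a q *m (al *: delta_mx p q + be *: delta_mx (rev_ord q) (rev_ord p))).
Proof.
move=> small large.
have t0 := tcoef_neq0; have W0 := wV_neq0 rh0 sh0; have Wd := wV_diag rh0 sh0.
have wa b : wpair rh sh (epsV b) alpha_pq = wV b p / wV b q.
  by rewrite alphaE wpairDr // wpairNr.
have wq : (wpair rh sh alpha_pq (epsV q))^-1 = rh / sh / wV p q.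
  by rewrite alphaE wpairDl // wpairNl -/(wV p q) -/(wV q q) Wd invf_div.
have r0 : r != 0 by rewrite expf_neq0.
have s0 : s != 0 by rewrite expf_neq0.
have be_y : al * t (rev_ord q) = - (rh / sh / wV p q * be * t (rev_ord p)).
  by apply: (mulIf (W0 n p q)); rewrite t_next; field; rewrite sh0 W0.
(* The powers of r and s with exponent n - q - 1 are replaced by free nonzero variables R and S,
   which leaves identities of rational functions. *)
have typ1 : (q < rev_ord p)%N -> exists R S, [/\ R != 0, S != 0, wV p q = (rh * sh)^-1,
    wV q p = rh * sh &
  [/\ t p = (s * S)^-1, t q = S^-1, t (rev_ord p) = (r * R)^-1 & t (rev_ord q) = R^-1] /\
  Theta_z p = (s - r) / r * (1 - (r * R) / (s * S)) /\ Theta_z q = (s - r) / r * (1 - R /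
      S)].
  case/small => _ _ pS qn; exists (r ^+ (n - q.+1)), (s ^+ (n - q.+1)).
  have pn : (p < n)%N by rewrite -ltnS pS ltnW.
  have np : (n - p.+1 = (n - q.+1).+1)%N by lia.
  rewrite !expf_neq0 // !wV_small // pq -[(q < p)%N]negbK -leqNgt (ltnW pq).
  split=> //; split; last by rewrite /Theta_z pn qn np !exprS.
  by rewrite !tcoef_rev_small ?tcoef_small // np !exprS.
apply: (Lop_step pq qp' p_next_q (wa := fun b => wpair rh sh (epsV b) alpha_pq)); rewrite
    ?wq.
- by move=> b _ _ _; rewrite wa /Theta_x; field; rewrite rh0 sh0 W0.
- move=> b _ _ _; rewrite /Theta_y.
  transitivity ((r - s) / r * t (rev_ord b) * (al * t (rev_ord q)) / (t (rev_ord p) * t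
      (rev_ord q))).
    by field; rewrite rh0 !t0.
  by rewrite be_y; field; rewrite rh0 sh0 W0 !t0.
- rewrite /Theta_x Wsr wa Wd; ring.
- rewrite wa Wd -Wsr /Theta_y.
  transitivity ((r - s) / r / t (rev_ord p) * (al * t (rev_ord q))).
    by field; rewrite rh0 !t0.
  have -> : wV q p = (wV p q)^-1 by apply: (mulIf (W0 n p q)); rewrite Wqp mulVf.
  by rewrite be_y; field; rewrite rh0 sh0 W0 !t0.
(* In [Theta_z p], the summand 1 comes from the x-coefficient at (p', q) and the quotient of powers
   from the y-coefficient. *)
- rewrite wa /Theta_x /Theta_y !wV_revl // Wd rev_ordK.
  case: ifP => [qp'lt|/negbT]; last first.
    rewrite -leqNgt leq_eqVlt eq_sym -[_ == _]/(q == rev_ord p) (negPf qp') /=.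
    by case/large => -> _; rewrite mulr0.
  have [R [S [R0 S0 Wpq Wqp' [[tp tq tp' tq'] [zp zq]]]]] := typ1 qp'lt.
  have [-> -> _ _] := small qp'lt.
  by rewrite zp Wpq tp tq'; field; rewrite rh0 sh0 R0 S0 oner_eq0.
- move=> qp'lt; rewrite wa /Theta_x /Theta_y !wV_revl // Wd rev_ordK.
  have [R [S [R0 S0 Wpq Wqp' [[tp tq tp' tq'] [zp zq]]]]] := typ1 qp'lt.
  have [-> -> _ _] := small qp'lt.
  by rewrite zq Wqp' tp tq'; field; rewrite rh0 sh0 R0 S0 ?oner_eq0.
- move=> qp'lt; rewrite /Theta_x /Theta_y !wV_revl // rev_ordK.
  have [R [S [R0 S0 Wpq Wqp' [[tp tq tp' tq'] [zp zq]]]]] := typ1 qp'lt.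
  have [-> -> _ _] := small qp'lt.
  by rewrite zq Wpq tq tp'; field; rewrite rh0 sh0 R0 S0 ?oner_eq0.
- by case/large.
Qed.
End Edge.

Hypothesis n_ge2 : (2 <= n)%N.
Variable rho : {lrmorphism U -> 'M[K]_N}.
Hypothesis hrho : is_fundamental rho.

Lemma Emx_delta (a b : 'I_N) : Emx K n a b = delta_mx a b.
Proof. by apply/matrixP => i j; rewrite !mxE. Qed.

Let rhoE i (a b c d : nat) (a' b' c' d' : 'I_N) : a' = a :> nat -> b' = b :> nat ->
  c' = c :> nat -> d' = d :> nat -> forall u v : K,
  rho (e i) = u *: Emx K n a b + v *: Emx K n c d ->
  rho (e i) = u *: delta_mx a' b' + v *: delta_mx c' d'.
Proof. by move=> <- <- <- <- u v; rewrite !Emx_delta. Qed.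

(* The raising operator that moves [v_q] to a multiple of [v_p]: every basis vector
   but the lowest one is reached. *)
Lemma raising_edge (p : 'I_N) : (p.+1 < N)%N -> exists i (q : 'I_N) al be,
  [/\ (p < q)%N, q != rev_ord p, al != 0,
      rho (e i) = al *: delta_mx p q + be *: delta_mx (rev_ord q) (rev_ord p) &
      forall a, al *: L a p =
        ((a == p)%:R * al) *: L q q + ((a == rev_ord q)%:R * be) *: L (rev_ord p) q
        + wpair rh sh (epsV a) (alpha i) *: (rho (e i) *m L a q)
        - (wpair rh sh (alpha i) (epsV q))^-1 *: (L a q *m rho (e i))].
Proof.
have r0 : r != 0 by rewrite expf_neq0.
have s0 : s != 0 by rewrite expf_neq0.
move=> pN; have [p1n|] := ltnP p.+1 n.
(* Inside the first half, the term E_(i,i+1) of e_i raises v_q to v_p. *)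
- have pn : (p < n)%N by lia.
  pose q : 'I_N := Ordinal pN; pose i : 'I_n := Ordinal pn.
  have ei : rho (e i) = 1 *: delta_mx p q + (-1) *: delta_mx (rev_ord q) (rev_ord p).
    apply: (@rhoE i i i.+1 (pr n i.+1) (pr n i)) => //.
    by rewrite (fundamental_e hrho) p1n scale1r scaleN1r.
  have ai : alpha i = epsV p - epsV q.
    apply/rowP => j; rewrite !mxE p1n /= /pr.
    have -> : (j == N - p.+1 :> nat)%N = false by have := ltn_ord j; lia.
    have -> : (j == N - p.+2 :> nat)%N = false by have := ltn_ord j; lia.
    by rewrite !subr0.
  have Wpq : wV p q = (rh * sh)^-1 by rewrite wV_small //= ltnS leqnn.
  have Wqp : wV q p = rh * sh by rewrite wV_small //= ltnS leqnn ltnNge leqnSn.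
  have pq : (p < q)%N by rewrite /=.
  have qp' : q != rev_ord p by apply/eqP => /(congr1 val) /=; lia.
  exists i, q, 1, (-1); split=> //; first exact: oner_neq0.
  move=> a; rewrite ei; apply: Lop_edge => //.
  + by move=> b /=; lia.
  + rewrite !tcoef_rev_small //= (_ : n - p.+1 = (n - p.+2).+1)%N; last by lia.
    by rewrite [r ^+ _.+1]exprS Wpq; field; rewrite ?oner_eq0 ?rh0 ?sh0 expf_neq0.
  + by rewrite Wpq Wqp mulfV // mulf_neq0 //.
  + by rewrite Wpq Wqp; field; rewrite ?oner_eq0 ?rh0 ?sh0.
  + by move=> /=; lia.
rewrite leq_eqVlt => /orP[/eqP np|np].
(* The middle edge: v_p is v_n, reached by e_n from v_(n-1)', two places further. The index in
   between is p'. *)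
- have q_lt : (p.+2 < N)%N by lia.
  have pn : (p < n)%N by lia.
  pose q : 'I_N := Ordinal q_lt; pose i : 'I_n := Ordinal pn.
  have i1n : (i.+1 < n)%N = false by rewrite /=; lia.
  have ei : rho (e i) = (-1) *: delta_mx p q + (r * s)^-1 *: delta_mx (rev_ord q)
      (rev_ord p).
    apply: (@rhoE i i (pr n i.-1) i.-1 (pr n i)) => //=; rewrite /pr ?(fundamental_e
        hrho); try lia.
    by rewrite i1n scaleN1r addrC.
  have ai : alpha i = epsV p - epsV q.
    apply/rowP => j; rewrite !mxE i1n /pr -val_eqE /=.
    have -> : (j == N - p.+1 :> nat)%N = false by have := ltn_ord j; lia.
    have -> : (j == p.+2 :> nat)%N = false by have := ltn_ord j; lia.
    have -> : (j == N - p.+3 :> nat)%N = (j.+1 == p) by lia.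
    by rewrite subr0 sub0r opprK addrC.
  have q0_lt : (p.-1 < N)%N by lia.
  pose q0 : 'I_N := Ordinal q0_lt.
  have qE : q = rev_ord q0 by apply/val_inj => /=; lia.
  have Wpq : wV p q = (rh * sh)^-1.
    rewrite qE wV_revr // wV_small //=; last by lia.
    by rewrite ifN ?ifT //; lia.
  have Wqp : wV q p = rh * sh.
    rewrite qE wV_revl // wV_small //=; last by lia.
    by rewrite ifT ?invrK //; lia.
  have pq : (p < q)%N by rewrite /=.
  have qp' : q != rev_ord p by apply/eqP => /(congr1 val) /=; lia.
  exists i, q, (-1), (r * s)^-1; split=> //; first by rewrite oppr_eq0 oner_eq0.
  move=> a; rewrite ei; apply: Lop_edge => //.
  + by move=> b /= pb; apply/val_inj => /=; lia.
  + rewrite (tcoef_rev_small pn) {1}qE rev_ordK tcoef_small /=; last by lia.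
    have -> : (n - p.+1 = 0)%N by lia.
    have -> : (n - p.-1.+1 = 1)%N by lia.
    by rewrite Wpq expr0 expr1; field; rewrite ?oner_eq0 ?rh0 ?sh0.
  + by rewrite Wpq Wqp mulfV // mulf_neq0 //.
  + by rewrite Wpq Wqp; field; rewrite ?oner_eq0 ?rh0 ?sh0.
  + by move=> /=; lia.
  + move=> _; rewrite /Theta_z pn ifN /=; last by lia.
    have -> : (n - p.+1 = 0)%N by lia.
    by rewrite !expr0 invr1 mulr1 subrr mulr0.
(* In the second half, v_q is raised to -v_p by the other term of e_i, whose 0-based index i equals
   q'. *)
- pose q : 'I_N := Ordinal pN.
  have i_lt : (N - q.+1 < n)%N by rewrite /=; lia.
  pose i : 'I_n := Ordinal i_lt.
  have i1n : (i.+1 < n)%N by rewrite /=; lia.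
  have ei : rho (e i) = (-1) *: delta_mx p q + 1 *: delta_mx (rev_ord q) (rev_ord p).
    apply: (@rhoE i (pr n i.+1) (pr n i) i i.+1) => //=; rewrite /pr /=; try lia.
    by rewrite (fundamental_e hrho) i1n scale1r scaleN1r addrC.
  have ai : alpha i = epsV p - epsV q.
    apply/rowP => j; rewrite !mxE i1n /pr -val_eqE /=.
    have -> : (j == p :> nat)%N = false by have := ltn_ord j; lia.
    have -> : (j == p.+1 :> nat)%N = false by have := ltn_ord j; lia.
    have -> : (N - p.+2).+1 = (N - p.+1)%N by lia.
    by rewrite !sub0r opprK addrC.
  have WE u v : wV u v = wV (rev_ord u) (rev_ord v) by rewrite wV_revl // wV_revr // invrK.
  have Wpq : wV p q = rh * sh.
    rewrite WE wV_small //=; try lia.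
    by rewrite ifN ?ifT //; lia.
  have Wqp : wV q p = (rh * sh)^-1.
    rewrite WE wV_small //=; try lia.
    by rewrite ifT //; lia.
  have pq : (p < q)%N by rewrite /=.
  have qp' : q != rev_ord p by apply/eqP => /(congr1 val) /=; lia.
  exists i, q, (-1), 1; split=> //; first by rewrite oppr_eq0 oner_eq0.
  move=> a; rewrite ei; apply: Lop_edge => //.
  + by move=> b /=; lia.
  + rewrite !tcoef_small /=; try lia.
    have -> : (n - (N - p.+2).+1 = (n - (N - p.+1).+1).+1)%N by lia.
    by rewrite Wpq [s ^+ _.+1]exprS; field; rewrite ?oner_eq0 ?rh0 ?sh0 expf_neq0.
  + by rewrite Wpq Wqp mulVf // mulf_neq0 //.
  + by rewrite Wpq Wqp; field; rewrite ?oner_eq0 ?rh0 ?sh0.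
  + by move=> /=; lia.
  + by move=> _; rewrite /Theta_z !ifN //=; lia.
Qed.

Variables (Delta : {lrmorphism U -> tensor U U}) (B : U -> U -> K).
Hypotheses (rs : rh ^+ 2 != sh ^+ 2) (hD : is_coproduct Delta) (hB : is_pairing Delta B).
Variables (d : 'rV[int]_n -> nat) (x y : forall mu, 'I_(d mu) -> U).
Arguments x : clear implicits.
Arguments y : clear implicits.
Hypothesis xy : are_dual_bases B x y.

Lemma rho_w_diag i (a b : 'I_N) :
  rho (w i) a b = (a == b)%:R * wpair rh sh (epsV b) (alpha i).
Proof.
have [/matrixP/(_ a 0) + _] := fundamental_weight hrho b i.
by rewrite -colE !mxE eqxx andbT mulrC.
Qed.

Lemma rho_w'_diag i (a b : 'I_N) :
  rho (w' i) a b = (a == b)%:R * (wpair rh sh (alpha i) (epsV b))^-1.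
Proof.
have [_ /matrixP/(_ a 0) +] := fundamental_weight hrho b i.
by rewrite -colE !mxE eqxx andbT mulrC.
Qed.

Lemma blk_Theta a b : blk (Theta_act rho x y) a b = L a b.
Proof.
have [m] := ubnP (N - b); elim: m a b => // m IHm a b; rewrite ltnS => bm.
have n_gt0 : (0 < n)%N by lia.
have [bN|Nb] := ltnP b.+1 N; last first.
  have {}bN : b.+1 = N by apply/eqP; rewrite eqn_leq Nb ltn_ord.
  apply/matrixP => c p; rewrite mxE (Theta_act_lowest n_gt0 hrho rh0 sh0 rs xy) // /Lop.
  have [ab|ab] := eqVneq a b; first by rewrite mxE.
  have ba : (b < a)%N = false by have := ltn_ord a; lia.
  have zb : Theta_z b = 0 by rewrite /Theta_z; case: ifP => //; lia.
  by rewrite ba zb scale0r; case: ifP; rewrite mxE.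
have [i [q [al [be [bq qb' al0 ei step]]]]] := raising_edge bN.
have IHq a' : blk (Theta_act rho x y) a' q = L a' q by apply: IHm; lia.
(* In column q, e_i has the single entry [al] in row p, because q differs from p'. The (a, q) block
   of the relation thus contains [al] times the unknown block (a, p), and otherwise only blocks in
   column q. *)
apply: (scalerI al0); rewrite step -!IHq.
have := blk_intertwine a q (Theta_act_intertwine n_gt0 hrho rh0 sh0 rs hD hB xy i).
rewrite {1 3}ei sum_row_delta2 sum_col_delta2.
under [X in _ + X = _]eq_bigr => a' _ do rewrite rho_w_diag -scalerA.
under [X in _ = _ + X]eq_bigr => b' _ do rewrite rho_w'_diag [b' == q]eq_sym -scalerA.
rewrite !(sum_pred1 predT) /= !scale1r eqxx mul1r (negPf qb') mul0r scale0r addr0.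
by move=> ->; rewrite addrK.
Qed.

End ThetaLOperators.

(** * The entries of the R-matrices *)

Section Entries.
Context (K : fieldType) (rh sh : K) (n : nat).
Hypotheses (rh0 : rh != 0) (sh0 : sh != 0).
Local Notation N := (2 * n)%N.
Local Notation r := (rh ^+ 2).
Local Notation s := (sh ^+ 2).
Local Notation wV := (@wV K rh sh n).
Local Notation t := (@tcoef K rh sh n).
Local Notation L := (Lop (@Theta_x K rh sh n) (@Theta_y K rh sh n) (@Theta_z K rh sh n)).
Implicit Types a c u v : 'I_N.

Let sum_pick (P : pred 'I_N) a (F : 'I_N -> K) :
  \sum_(i | P i) (a == i)%:R * F i = (P a)%:R * F a.
Proof.
rewrite big_mkcond (bigD1 a) //= eqxx big1 ?addr0 => [|i ia].
  by case: (P a); rewrite ?mul1r ?mul0r.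
by rewrite eq_sym (negPf ia) mul0r if_same.
Qed.

Lemma flipE a c u v :
  flip K n (mxtens_index (a, c)) (mxtens_index (u, v)) = (v == a)%:R * (u == c)%:R.
Proof.
rewrite /flip summxE.
transitivity (\sum_(k < N) (u == k)%:R * ((k == c)%:R * (v == a)%:R) : K).
  apply: eq_bigr => k _; rewrite summxE.
  transitivity (\sum_(l < N) (v == l)%:R * ((u == k)%:R * (k == c)%:R * (l == a)%:R) : K).
    apply: eq_bigr => l _; rewrite tensmxE !mxE -!mulnb !natrM [a == l]eq_sym [c ==
        k]eq_sym; ring.
  by rewrite (sum_pick predT) /=; ring.
by rewrite (sum_pick predT) /=; ring.
Qed.

Lemma ftildeE a c u v :
  ftilde rh sh n (mxtens_index (a, c)) (mxtens_index (u, v)) =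
  (u == a)%:R * ((v == c)%:R * (wV v u)^-1).
Proof.
rewrite /ftilde summxE.
transitivity (\sum_(k < N) (u == k)%:R * ((k == a)%:R * ((v == c)%:R * (wV v k)^-1)) : K).
  apply: eq_bigr => k _; rewrite summxE.
  transitivity (\sum_(l < N) (v == l)%:R * ((u == k)%:R * (k == a)%:R * (l == c)%:R * (wV
      l k)^-1) : K).
    apply: eq_bigr => l _; rewrite mxE tensmxE !mxE -!mulnb !natrM [a == k]eq_sym [c ==
        l]eq_sym /wV.
    ring.
  by rewrite (sum_pick predT) /=; ring.
by rewrite (sum_pick predT) /=; ring.
Qed.

(** The flip sends the column (u, v) to (v, u), where f~ is the scalar (omega'_mu,
    omega_lambda)^(-1) for lambda the weight of v_v and mu that of v_u. *)
Lemma mul_ftilde_flip (T : 'M[K]_(N * N)) a c u v :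
  (T *m ftilde rh sh n *m flip K n) (mxtens_index (a, c)) (mxtens_index (u, v)) =
  blk T a v c u / wV u v.
Proof.
rewrite !mxE sum_mxtens_index.
transitivity (\sum_k (v == k)%:R * ((T *m ftilde rh sh n) (mxtens_index (a, c))
    (mxtens_index (k, u)))).
  apply: eq_bigr => k _.
  transitivity (\sum_l (u == l)%:R * ((v == k)%:R * (T *m ftilde rh sh n) (mxtens_index
      (a, c)) (mxtens_index (k, l)))).
    by apply: eq_bigr => l _; rewrite flipE; ring.
  by rewrite (sum_pick predT) mul1r.
rewrite (sum_pick predT) mul1r mxE sum_mxtens_index.
transitivity (\sum_k (v == k)%:R * (T (mxtens_index (a, c)) (mxtens_index (k, u)) / wV u
    v)).
  apply: eq_bigr => k _.
  transitivity (\sum_l (u == l)%:R * ((v == k)%:R * (T (mxtens_index (a, c))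
      (mxtens_index (k, l)) / wV u v))).
    by apply: eq_bigr => l _; rewrite ftildeE; ring.
  by rewrite (sum_pick predT) mul1r.
by rewrite (sum_pick predT) mul1r.
Qed.

Lemma RhatE a c u v :
  Rhat rh sh n (mxtens_index (a, c)) (mxtens_index (u, v)) =
    rh^-1 * sh * ((a == u)%:R * (a == c)%:R * (a == v)%:R)
  + rh * sh^-1 * ((u == rev_ord a)%:R * (c == rev_ord a)%:R * (a == v)%:R)
  + ((u != a) && (u != rev_ord a))%:R * (acoef rh sh a u * (c == u)%:R * (a == v)%:R)
  + (s - r) / (rh * sh) * ((c < n)%:R * ((1 - r ^+ (n - c.+1) * s ^- (n - c.+1))
      * ((a == rev_ord c)%:R * (u == rev_ord c)%:R * (v == c)%:R)))
  + (s - r) / (rh * sh) * (((v < a)%N && (v != rev_ord a))%:R * ((u == a)%:R * (v == c)%:R))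
  + (r - s) / (rh * sh) * (((c < u)%N && (u != rev_ord c))%:R *
      (t c / t u * ((a == rev_ord c)%:R * (v == rev_ord u)%:R))).
Proof.
rewrite /Rhat !mxE !summxE; congr (_ + _ + _ + _ + _ + _).
- congr (_ * _); transitivity (\sum_i (a == i)%:R * ((u == i)%:R * (c == i)%:R * (v ==
    i)%:R) : K).
    by apply: eq_bigr => i _; rewrite tensmxE !mxE -!mulnb !natrM; ring.
  by rewrite (sum_pick predT) mul1r ![_ == a]eq_sym.
- congr (_ * _); transitivity (\sum_i (a == i)%:R * ((u == rev_ord i)%:R * (c == rev_ord
    i)%:R * (v == i)%:R) : K).
    by apply: eq_bigr => i _; rewrite tensmxE !mxE -!mulnb !natrM; ring.
  by rewrite (sum_pick predT) mul1r [v == a]eq_sym.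
- transitivity (\sum_i (a == i)%:R * (((u != i) && (u != rev_ord i))%:R * (acoef rh sh i
    u * (c == u)%:R * (v == i)%:R)) : K).
    apply: eq_bigr => i _; rewrite summxE.
    transitivity (\sum_(j | (j != i) && (j != rev_ord i)) (u == j)%:R * ((a == i)%:R *
        (acoef rh sh i j * (c == j)%:R * (v == i)%:R)) : K).
      by apply: eq_bigr => j _; rewrite mxE tensmxE !mxE -!mulnb !natrM; ring.
    by rewrite sum_pick; ring.
  by rewrite (sum_pick predT) mul1r [v == a]eq_sym.
- congr (_ * _); transitivity (\sum_(i : 'I_N | (i < n)%N) (c == i)%:R * ((1 - r ^+ (n -
    i.+1) * s ^- (n - i.+1))
      * ((a == rev_ord i)%:R * (u == rev_ord i)%:R * (v == i)%:R)) : K).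
    by apply: eq_bigr => i _; rewrite mxE tensmxE !mxE -!mulnb !natrM; ring.
  by rewrite sum_pick.
- congr (_ * _); transitivity (\sum_i (a == i)%:R * (((v < i)%N && (v != rev_ord i))%:R *
    ((u == i)%:R * (c == v)%:R)) : K).
    apply: eq_bigr => i _; rewrite summxE.
    transitivity (\sum_(j : 'I_N | (j < i)%N && (j != rev_ord i)) (v == j)%:R * ((a ==
        i)%:R * ((u == i)%:R * (c == j)%:R)) : K).
      by apply: eq_bigr => j _; rewrite tensmxE !mxE -!mulnb !natrM; ring.
    by rewrite sum_pick; ring.
  by rewrite (sum_pick predT) mul1r [c == v]eq_sym.
- congr (_ * _); transitivity (\sum_i (c == i)%:R * (((i < u)%N && (u != rev_ord i))%:R *
    (t i / t u * ((a == rev_ord i)%:R * (v == rev_ord u)%:R))) : K).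
    apply: eq_bigr => i _; rewrite summxE.
    transitivity (\sum_(j : 'I_N | (i < j)%N && (j != rev_ord i)) (u == j)%:R * ((c ==
        i)%:R * (t i / t j * ((a == rev_ord i)%:R * (v == rev_ord j)%:R))) : K).
      by apply: eq_bigr => j _; rewrite mxE tensmxE !mxE -!mulnb !natrM; ring.
    by rewrite sum_pick; ring.
  by rewrite (sum_pick predT) mul1r.
Qed.

(** The origin of a_ij: the diagonal blocks of Theta are identities, so f~ alone produces these
    entries. *)
Lemma acoefE a u : u != a -> u != rev_ord a -> acoef rh sh a u = (wV u a)^-1.
Proof.
move=> /eqP ua /eqP ua'; have {}ua : u <> a :> nat by move=> /val_inj.
have {}ua' : u <> (N - a.+1)%N :> nat by move=> h; apply: ua'; apply/val_inj.
have aN := ltn_ord a; have uN := ltn_ord u.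
rewrite /acoef /sigma /=.
(* The minimum of an index and its dual gives the eps_k in the weight, and the half containing the
   index gives its sign. Opposite signs invert the scalar. *)
have WE : wV u a = if (u < n)%N == (a < n)%N then
    (if (minn u (N - u.+1) < minn a (N - a.+1))%N then (rh * sh)^-1 else rh * sh)
    else (if (minn u (N - u.+1) < minn a (N - a.+1))%N then rh * sh else (rh * sh)^-1).
  have small b : (n <= b < N)%N -> (N - b.+1 < n)%N by lia.
  have [un|nu] := ltnP u n; have [an|na] := ltnP a n.
  - rewrite wV_small //=; case: ifP => h1; first by rewrite ifT //; lia.
    by rewrite ifT; [rewrite ifN //|]; lia.
  - rewrite -[a]rev_ordK wV_revr // wV_small //=; last by lia.
    case: ifP => h1; first by rewrite ifT ?invrK //; lia.
    by rewrite ifT; [rewrite ifN //|]; lia.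
  - rewrite -[u]rev_ordK wV_revl // wV_small //=; last by lia.
    case: ifP => h1; first by rewrite ifT ?invrK //; lia.
    by rewrite ifT; [rewrite ifN //|]; lia.
  - rewrite -[u]rev_ordK -[a]rev_ordK wV_revl // wV_revr // invrK wV_small //=; try lia.
    case: ifP => h1; first by rewrite ifT //; lia.
    by rewrite ifT; [rewrite ifN //|]; lia.
rewrite WE; case: ifP => h1; case: (ltnP u n) h1 => hu; case: (ltnP a n) => ha h1;
  rewrite /= ?mulr1 ?mulN1r ?opprK ?expr1z ?exprN1;
  case: ifP => h2 //; rewrite ?invrK //; lia.
Qed.

(** The position of the block (a, v) selects the summands of R^: the first three live on a = v, the
    fourth on a = v', the last two on the remaining blocks below the diagonal. *)
Lemma Lop_Rhat a c u v :
  L a v c u / wV u v = Rhat rh sh n (mxtens_index (a, c)) (mxtens_index (u, v)).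
Proof.
have r0 : r != 0 by rewrite expf_neq0.
have s0 : s != 0 by rewrite expf_neq0.
have W0 := wV_neq0 rh0 sh0; have Wd := wV_diag rh0 sh0.
have revK (x : 'I_N) : rev_ord (rev_ord x) = x := rev_ordK x.
have rev_eq (x y : 'I_N) : (x == rev_ord y) = (y == rev_ord x) :> bool.
  by rewrite -(inj_eq rev_ord_inj) revK eq_sym.
have rev_neq (x : 'I_N) : (x == rev_ord x) = false
  by apply/eqP => h; have := congr1 (fun y : 'I_N => nat_of_ord y) h => /= h1; have :=
      ltn_ord x; lia.
have rev_lt (x y : 'I_N) : (rev_ord x < rev_ord y)%N = (y < x)%N.
  by rewrite /=; have := ltn_ord x; have := ltn_ord y; lia.
have simp := (mulr0, mul0r, mulr1, mul1r, addr0, add0r).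
rewrite RhatE /Lop.
have [<-|av] := eqVneq a v.
  have -> : (a == rev_ord c)%:R * (u == rev_ord c)%:R * (a == c)%:R = 0 :> K.
    by have [<-|_] := eqVneq a c; rewrite ?rev_neq !simp.
  have -> : ((c < u)%N && (u != rev_ord c))%:R * (t c / t u * ((a == rev_ord c)%:R * (a
      == rev_ord u)%:R)) = 0.
    rewrite [a == rev_ord c]rev_eq [a == rev_ord u]rev_eq.
    by have [->|_] := eqVneq c (rev_ord a); have [->|_] := eqVneq u (rev_ord a); rewrite
        ?ltnn !simp.
  rewrite ltnn !simp mxE; have [->|ua] := eqVneq u a.
    by rewrite rev_neq ?eqxx !simp Wd [c == a]eq_sym; field; rewrite ?rh0 ?sh0.
  rewrite !simp /=; have [->|ua'] := eqVneq u (rev_ord a).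
    by rewrite wV_revl // Wd !simp; field; rewrite ?rh0 ?sh0.
  by rewrite !simp /= acoefE // mulrC.
rewrite !simp; have [->|av'] := eqVneq a (rev_ord v).
  have -> : ((c < u)%N && (u != rev_ord c))%:R *
      (t c / t u * ((rev_ord v == rev_ord c)%:R * (v == rev_ord u)%:R)) = 0 :> K.
    rewrite (inj_eq rev_ord_inj) [v == rev_ord u]rev_eq.
    by have [->|_] := eqVneq v c; have [->|_] := eqVneq u (rev_ord c); rewrite ?eqxx
        ?andbF !simp.
  rewrite revK (inj_eq rev_ord_inj) ?eqxx ?andbF !simp mxE mxE -mulnb natrM.
  have [->|_] := eqVneq v c; last by rewrite !simp.
  have [->|_] := eqVneq u (rev_ord c); last by rewrite !simp.
  rewrite /Theta_z wV_revl // Wd !simp; case: ifP => _; rewrite !simp //.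
  by field; rewrite ?expf_neq0 ?rh0 ?sh0.
have -> : (a == rev_ord c)%:R * (u == rev_ord c)%:R * (v == c)%:R = 0 :> K.
  have [vc|_] := eqVneq v c; last by rewrite !simp.
  by rewrite -vc (negPf av') !simp.
rewrite [v == rev_ord a]rev_eq (negPf av') andbT !simp.
rewrite [a == rev_ord c]rev_eq [v == rev_ord u]rev_eq.
(* In the last sum c = a' and u = v', and duality reverses the order: c < u means v < a. *)
have -> : ((c < u)%N && (u != rev_ord c))%:R * (t c / t u * ((c == rev_ord a)%:R * (u ==
    rev_ord v)%:R)) =
   (v < a)%N%:R * (t (rev_ord a) / t (rev_ord v) * ((c == rev_ord a)%:R * (u == rev_ord
       v)%:R)).
  have [->|_] := eqVneq c (rev_ord a); last by rewrite !simp.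
  have [->|_] := eqVneq u (rev_ord v); last by rewrite !simp.
  by rewrite revK rev_lt eq_sym av' andbT.
case: ltnP => _; last by rewrite mxE !simp.
rewrite !mxE -!mulnb !natrM /Theta_x /Theta_y [v == c]eq_sym.
have [->|ua] := eqVneq u a.
  rewrite (negPf av') !simp; field; rewrite ?rh0 ?sh0 ?W0 //.
have [->|_] := eqVneq u (rev_ord v); last by rewrite !simp.
by rewrite wV_revl // Wd !simp; field; rewrite ?rh0 ?sh0 ?tcoef_neq0.
Qed.

End Entries.

Theorem theorem4p6
    (R : realType) (K : closedFieldType)
    (iota : {rmorphism {fraction {poly {poly R[i]}}} -> K})
    (rh sh : K)
    (rh2 : rh ^+ 2 = iota (tofrac ('X%:P : {poly {poly R[i]}})))
    (sh2 : sh ^+ 2 = iota (tofrac ('X : {poly {poly R[i]}})))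
    (n : nat) (n_ge2 : (2 <= n)%N)
    (Delta : {lrmorphism Urs rh sh n -> tensor (Urs rh sh n) (Urs rh sh n)})
    (Delta_coproduct : is_coproduct Delta)
    (B : Urs rh sh n -> Urs rh sh n -> K)
    (B_pairing : is_pairing Delta B)
    (d : 'rV[int]_n -> nat)
    (x y : forall mu : 'rV[int]_n, 'I_(d mu) -> Urs rh sh n)
    (xy_dual : are_dual_bases B x y)
    (rho : {lrmorphism Urs rh sh n -> 'M[K]_(2 * n)})
    (rho_fundamental : is_fundamental rho) :
  RVV rho x y = Rhat rh sh n.
Proof.
have rh0 : rh != 0.
  by rewrite -sqrf_eq0 rh2 fmorph_eq0 tofrac_eq0 polyC_eq0 polyX_eq0.
have sh0 : sh != 0 by rewrite -sqrf_eq0 sh2 fmorph_eq0 tofrac_eq0 polyX_eq0.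
have rs : rh ^+ 2 != sh ^+ 2.
  rewrite rh2 sh2 (inj_eq (fmorph_inj iota)) tofrac_eq.
  (* As polynomials in the outer variable, [r] is constant and [s] is the variable, so their sizes
     differ. *)
  apply/eqP => /(congr1 (fun p : {poly {poly R[i]}} => size p)).
  by rewrite size_polyX size_polyC; case: (_ != 0).
apply/matrixP => i j; case: (mxtens_indexP i) => a c; case: (mxtens_indexP j) => u v.
rewrite /RVV mul_ftilde_flip -Lop_Rhat //; congr (_ / _).
by rewrite (blk_Theta rh0 sh0 n_ge2 rho_fundamental rs Delta_coproduct B_pairing xy_dual).
Qed.
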